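(* Let $a>0$ and $n\ge 1$. There is a constant $C$ (depending only on $a$ and $n$) such that for every $\lambda\ge 1$, every interval $J\subset[0,1]$, and every $f\in L^2(\mathbb{R}^n)$ with $\operatorname{supp}\hat f\subset B(0;\lambda)=\{\xi\in\mathbb{R}^n: |\xi|\le\lambda\}$, one has $$\Big\|\sup_{t\in J}|S_tf|\Big\|_{L^2(\mathbb{R}^n)}\le\big(1+C|J|^{1/2}\lambda^{a/2}\big)\|f\|_{L^2(\mathbb{R}^n)}.$$
   Context: The Fourier transform is $\hat f(\xi)=\int_{\mathbb{R}^n}e^{-i\xi\cdot x}f(x)\,dx$. For $a>0$ and $t\ge0$, $S_tf(x)=(2\pi)^{-n}\int_{\mathbb{R}^n}e^{i\xi\cdot x}e^{it|\xi|^a}\hat f(\xi)\,d\xi$, $x\in\mathbb{R}^n$ (defined pointwise when $\hat f\in L^2$ has compact support). $|J|$ is the length of $J$. *)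

(* Defs.v *)
From HB Require Import structures.
From mathcomp Require Import all_boot all_order all_algebra.
From mathcomp Require Import complex.
From mathcomp Require Import all_classical all_reals all_analysis.

Set Implicit Arguments.
Unset Strict Implicit.
Unset Printing Implicit Defensive.

Import Order.TTheory GRing.Theory Num.Theory.
Import numFieldNormedType.Exports.

Local Open Scope classical_set_scope.
Local Open Scope complex_scope.
Local Open Scope ring_scope.

(* R^n with its Borel sigma-algebra (the product of the Borel sigma-algebras). *)
Notation Rn R n := (n.-tuple (measurableTypeR R)).

Section lebesgue_Rn.
Variable R : realType.

Definition cons_Rn n (p : measurableTypeR R * Rn R n) : Rn R n.+1 :=
  [the n.+1.-tuple (measurableTypeR R) of p.1 :: p.2].

Lemma measurable_cons_Rn n : measurable_fun setT (@cons_Rn n).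
Proof. exact: measurable_cons. Qed.

Section step.
Variables (n : nat) (mu : {sigma_finite_measure set (Rn R n) -> \bar R}).

Definition lebesgue_step : set (Rn R n.+1) -> \bar R :=
  pushforward (@lebesgue_measure R \x mu)%E (@cons_Rn n).

Let mcons A : measurable A -> measurable (@cons_Rn n @^-1` A).
Proof. by move=> mA; rewrite -[X in measurable X]setTI; exact: measurable_cons_Rn. Qed.

Let step0 : lebesgue_step set0 = 0%E.
Proof. by rewrite /lebesgue_step /pushforward preimage_set0 measure0. Qed.

Let step_ge0 A : (0 <= lebesgue_step A)%E.
Proof. by rewrite /lebesgue_step /pushforward; exact: measure_ge0. Qed.

Let step_sigma_additive : semi_sigma_additive lebesgue_step.
Proof.
move=> F mF tF mUF; rewrite /lebesgue_step /pushforward preimage_bigcup.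
apply: measure_semi_sigma_additive.
- by move=> k; exact: mcons.
- apply/trivIsetP => /= i j _ _ ij; rewrite -preimage_setI.
  by move/trivIsetP : tF => /(_ _ _ _ _ ij) ->//; rewrite preimage_set0.
- by rewrite -preimage_bigcup; exact: mcons.
Qed.

HB.instance Definition _ := isMeasure.Build _ _ _ lebesgue_step
  step0 step_ge0 step_sigma_additive.

Let uncons (x : Rn R n.+1) : measurableTypeR R * Rn R n :=
  (thead x, [tuple of behead x]).

Let consK : cancel (@cons_Rn n) uncons.
Proof. by case=> a t; rewrite /uncons /cons_Rn /=; congr pair; exact/val_inj. Qed.

Let muncons : measurable_fun setT uncons.
Proof.
apply/measurable_fun_pairP; split; last exact: measurable_behead.
exact: measurable_tnth.
Qed.

Let step_sigma_finite : sigma_finite setT lebesgue_step.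
Proof.
have /sigma_finiteP[F [TF ndF Foo]] := sigma_finiteT (@lebesgue_measure R).
have /sigma_finiteP[G [TG ndG Goo]] := sigma_finiteT mu.
exists (fun k => uncons @^-1` (F k `*` G k)).
  rewrite -preimage_bigcup -[LHS](preimage_setT uncons); congr (_ @^-1` _).
  rewrite -setXTT TF TG predeqE => -[x y]; split.
    move=> [/= [k _ Fkx] [l _ Gly]]; exists (maxn k l) => //; split.
    - by move: x Fkx; exact/subsetPset/ndF/leq_maxl.
    - by move: y Gly; exact/subsetPset/ndG/leq_maxr.
  by move=> [k _ []/= ? ?]; split; exists k.
move=> k; have [mF Fk] := Foo k; have [mG Gk] := Goo k; split.
  by rewrite -[X in measurable X]setTI; apply: muncons => //; exact: measurableX.
rewrite /lebesgue_step /pushforward -comp_preimage.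
rewrite (_ : uncons \o _ = id); last by apply/funext => p; exact: consK.
by rewrite preimage_id product_measure1E// lte_mul_pinfty// ge0_fin_numE.
Qed.

HB.instance Definition _ := Measure_isSigmaFinite.Build _ _ _
  lebesgue_step step_sigma_finite.

End step.

Fixpoint lebesgue_Rn n : {sigma_finite_measure set (Rn R n) -> \bar R} :=
  match n with
  | 0 => [the {sigma_finite_measure set (Rn R 0) -> \bar R}
           of \d_([tuple] : Rn R 0)]
  | m.+1 => [the {sigma_finite_measure set (Rn R m.+1) -> \bar R}
           of lebesgue_step (lebesgue_Rn m)]
  end.

Lemma lebesgue_Rn_box n (A : 'I_n -> set (measurableTypeR R)) :
  (forall i, measurable (A i)) ->
  lebesgue_Rn n [set x | forall i, A i (tnth x i)] =
  (\prod_(i < n) lebesgue_measure (A i))%E.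
Proof.
elim: n A => [|n ih] A mA.
  rewrite big_ord0 /= diracE mem_set//= => -[] //.
rewrite big_ord_recl -ih//= /lebesgue_step /pushforward.
rewrite -product_measure1E//; last first.
  rewrite (_ : mkset _ = \big[setI/setT]_(i < n)
      ((fun x : Rn R n => tnth x i) @^-1` A (lift ord0 i))).
    apply: bigsetI_measurable => i _; rewrite -[X in measurable X]setTI.
    exact: measurable_tnth.
  apply/seteqP; split => x /=.
    by move=> Ax; rewrite -bigcap_seq => i _; exact: Ax.
  by rewrite -bigcap_seq => Ax i; apply: Ax; rewrite /= mem_index_enum.
congr (_ _); apply/seteqP; split => -[a x] /=.
  move=> h; split; first exact: (h ord0).
  by move=> i; move: (h (lift ord0 i)); rewrite tnthS.
move=> [h0 h] i; case: (unliftP ord0 i) => [j ->|->]; last exact: h0.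
by rewrite tnthS; exact: h.
Qed.

End lebesgue_Rn.
Arguments lebesgue_Rn {R} n.

Section fourier.
Variables (R : realType) (n : nat).
Implicit Types (x y xi : Rn R n) (f g : Rn R n -> R[i]) (p : \bar R).

Definition dotp x y : R := \sum_(i < n) (tnth x i : R) * (tnth y i : R).

Definition enorm x : R := Num.sqrt (dotp x x).

Definition edist x y : R :=
  Num.sqrt (\sum_(i < n) ((tnth x i : R) - (tnth y i : R)) ^+ 2).

Definition expi (theta : R) : R[i] := cos theta +i* sin theta.

Definition Cintegral f : R[i] :=
  (\int[lebesgue_Rn n]_x complex.Re (f x)) +i*
  (\int[lebesgue_Rn n]_x complex.Im (f x)).

Definition LpnormC p f : \bar R :=
  Lnorm (lebesgue_Rn n) p (fun x => (Normc.normc (f x))%:E).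

Definition LpC p : set (Rn R n -> R[i]) := [set f |
  [/\ measurable_fun setT (fun x => complex.Re (f x)),
      measurable_fun setT (fun x => complex.Im (f x)) &
      (LpnormC p f < +oo)%E]].

Definition fourier_integral f xi : R[i] :=
  Cintegral (fun x => expi (- dotp xi x) * f x).

(* g is (a representative of) the Fourier transform of f in L^2, defined by
   continuous extension from L^1 `&` L^2, where it is given by the integral. *)
Definition is_fourier f g : Prop :=
  [/\ LpC 2%:E f, LpC 2%:E g &
   exists F : nat -> Rn R n -> R[i],
   [/\ forall k, LpC 1%:E (F k) /\ LpC 2%:E (F k),
      (fun k => LpnormC 2%:E (fun x => F k x - f x)) @ \oo --> 0%E &
      (fun k => LpnormC 2%:E (fun xi => fourier_integral (F k) xi - g xi))
        @ \oo --> 0%E]].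

(* Support of the class of g modulo a.e. equality: the complement of the
   largest open set on which g vanishes almost everywhere. *)
Definition ess_support g : set (Rn R n) := [set xi |
  forall r : R, 0 < r ->
    ~ {ae lebesgue_Rn n, forall eta, edist xi eta < r -> g eta = 0}].

(* S_t f at x, as a function of the Fourier transform fhat of f. *)
Definition propagator (a t : R) (fhat : Rn R n -> R[i]) x : R[i] :=
  ((2 * pi) ^- n)%:C *
  Cintegral (fun xi => expi (dotp xi x) * expi (t * enorm xi `^ a) * fhat xi).

(* The supremum is taken in [0, +oo]; this only matters for empty J, where
   ereal_sup would give -oo. *)
Definition maximal_propagator (a : R) (J : set R) (fhat : Rn R n -> R[i]) x
  : \bar R :=
  maxe 0%E
    (ereal_sup [set (Normc.normc (propagator a t fhat x))%:E | t in J]).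

End fourier.

(* Main.v *)
(* For fixed x put F(t) = S_t f(x). Then |F(t)|^2 <= |F(s)|^2 + int_J 2 |F| |F'|
   for s, t in J, and 2 |F| |F'| <= L |F|^2 + |F'|^2 / L with L = lambda^a. Both
   F and F' / L have L^2 norm at most ||f|| in x, for every t, so that
   integrating in x gives || sup_J |S_t f| ||^2 <= (1 + 2 L |J|) ||f||^2.

   Only the inequality half of Plancherel is needed, for g in L^1 and L^2. It
   comes from the weight W(xi) = prod_i exp (- e |xi_i|), whose Fourier
   transform is a product of Poisson kernels: expanding the square, the integral
   of W |g^|^2 is that of Re (g(x) conj(g(y))) K(x - y) with K >= 0 of total
   mass (2 pi)^n, hence at most (2 pi)^n ||g||^2; then e tends to 0. *)

From HB Require Import structures.
Require Import Defs.
From mathcomp Require Import all_boot all_order all_algebra.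
From mathcomp Require Import complex.
From mathcomp Require Import all_classical all_reals all_analysis.
From mathcomp Require Import ring lra measurable_realfun.
Set Implicit Arguments.
Unset Strict Implicit.
Unset Printing Implicit Defensive.
Import Order.TTheory GRing.Theory Num.Theory.
Import numFieldNormedType.Exports.
Local Open Scope classical_set_scope.
Local Open Scope ring_scope.

(** * Integration on product spaces *)

(** The leading constant is exactly 1 although only an inequality is taken from Plancherel: it is
    used once from [f] to [fhat] and once from [fhat] to S_t f, each time with loss (2 pi)^(n/2),
    and the factor (2 pi)^(-n) of the propagator cancels both losses. The constant C = sqrt 2 then
    comes from sqrt (1 + y^2) <= 1 + y with y^2 = 2 L |J|. The supremum over an uncountable J is
    never shown to be measurable. It is dominated at every x by a function whose integral Tonelli
    computes, and monotonicity of integrals of nonnegative functions needs no measurability. The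
    bounds must then hold at each x for all t, so amplitude and symbol are both cut off to the ball:
    the amplitude becomes integrable, the symbol is bounded by L everywhere, and differentiation
    under the integral is legitimate for each x and t. The exponential weight has explicit
    antiderivatives against cosines and factors over the coordinates, so its transform reduces to a
    computation on the line. *)

Lemma le_integral_nonneg d (T : measurableType d) (R : realType)
    (mu : {measure set T -> \bar R}) (f g : T -> \bar R) :
  (forall x, 0 <= f x)%E -> (forall x, f x <= g x)%E ->
  (\int[mu]_x f x <= \int[mu]_x g x)%E.
Proof.
move=> f0 fg.
have g0 x : (0 <= g x)%E by exact: le_trans (fg x).
(* The integral of a nonnegative function is a supremum over the simple functions below it, so
   neither side has to be measurable. *)
rewrite !ge0_integralTE//; apply: ereal_sup_le => _ [h hf <-].
by exists h => // x; exact: le_trans (fg x).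
Qed.

Section product.
Context d1 d2 (X : measurableType d1) (Y : measurableType d2) (R : realType).
Variables (mu : {sigma_finite_measure set X -> \bar R})
  (nu : {sigma_finite_measure set Y -> \bar R}).

(** Tonelli gives measurability for nonnegative integrands only, hence the split into positive and
    negative parts. No integrability is asked: [fine] is measurable and sends infinite values to
    0. *)
Lemma measurable_Rintegral_param (f : X * Y -> R) : measurable_fun setT f ->
  measurable_fun setT (fun x => \int[nu]_y f (x, y)).
Proof.
move=> mf.
have mF : measurable_fun setT (EFin \o f) by exact/measurable_EFinP.
have -> : (fun x => \int[nu]_y f (x, y)) =
    fine \o ((fun x => \int[nu]_y (EFin \o f)^\+ (x, y)) \-
             (fun x => \int[nu]_y (EFin \o f)^\- (x, y)))%E.
  apply/funext => x; rewrite /Rintegral [in LHS]integralE /=.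
  by congr (fine (_ - _)%E); apply: eq_integral => y _; rewrite ?funeposE ?funenegE.
apply: measurableT_comp => //.
apply: emeasurable_funB; apply: measurable_fun_fubini_tonelli_F => //.
- exact: measurable_funepos.
- exact: measurable_funeneg.
Qed.

Lemma integrable_prod (p : X -> R) (q : Y -> R) :
  mu.-integrable setT (EFin \o p) -> nu.-integrable setT (EFin \o q) ->
  (mu \x nu)%E.-integrable setT (EFin \o (fun z => p z.1 * q z.2)).
Proof.
move=> /integrableP[mp ip] /integrableP[mq iq].
move/measurable_EFinP in mp; move/measurable_EFinP in mq.
apply/integrable12ltyP.
  apply/measurable_EFinP/measurable_funM.
    exact: (measurableT_comp mp measurable_fst).
  exact: (measurableT_comp mq measurable_snd).
under eq_integral => x _.
  under eq_integral => y _ do rewrite /= normrM EFinM.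
  rewrite ge0_integralZl//; last exact/measurable_EFinP/measurableT_comp.
  over.
rewrite ge0_integralZr//; last 2 first.
  exact/measurable_EFinP/measurableT_comp.
  exact: integral_ge0.
by rewrite lte_mul_pinfty// ?integral_ge0// ge0_fin_numE// integral_ge0.
Qed.

Lemma Rintegral_prod (p : X -> R) (q : Y -> R) :
  mu.-integrable setT (EFin \o p) -> nu.-integrable setT (EFin \o q) ->
  \int[(mu \x nu)%E]_z (p z.1 * q z.2) = (\int[mu]_x p x) * (\int[nu]_y q y).
Proof.
move=> ip iq; have ipq := integrable_prod ip iq.
rewrite -[RHS]/(fine (_%:E)) /Rintegral; congr fine.
rewrite -integral12_prod_meas1// /fubini_F /=.
under eq_integral => x _.
  under eq_integral => y _ do rewrite EFinM.
  rewrite integralZl//; over.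
rewrite EFinM !fineK; [|exact: integrable_fin_num..].
rewrite -(fineK (integrable_fin_num measurableT iq)).
by rewrite integralZr.
Qed.

(* The library registers [mu \x nu] as sigma-finite only for subprobabilities. *)
Definition sigma_finite_prod : set (X * Y)%type -> \bar R := (mu \x nu)%E.

HB.instance Definition _ := Measure.on sigma_finite_prod.

Let sigma_finite_prodT : sigma_finite setT sigma_finite_prod.
Proof.
have /sigma_finiteP[F [TF ndF Foo]] := sigma_finiteT mu.
have /sigma_finiteP[G [TG ndG Goo]] := sigma_finiteT nu.
exists (fun k => F k `*` G k) => [|k].
  apply/esym/seteqP; split=> // -[x y] _.
  have [i _ Fx] : (\bigcup_k F k) x by rewrite -TF.
  have [j _ Gy] : (\bigcup_k G k) y by rewrite -TG.
  exists (maxn i j) => //; split.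
    by move: x Fx; exact/subsetPset/ndF/leq_maxl.
  by move: y Gy; exact/subsetPset/ndG/leq_maxr.
have [mF Fk] := Foo k; have [mG Gk] := Goo k; split; first exact: measurableX.
by rewrite [ltLHS]product_measure1E// lte_mul_pinfty// ge0_fin_numE.
Qed.

HB.instance Definition _ :=
  Measure_isSigmaFinite.Build _ _ _ sigma_finite_prod sigma_finite_prodT.

End product.

Lemma integrable_le d (T : measurableType d) (R : realType)
    (mu : {measure set T -> \bar R}) (f g : T -> R) :
  measurable_fun setT f -> mu.-integrable setT (EFin \o g) ->
  (forall x, `|f x| <= g x) -> mu.-integrable setT (EFin \o f).
Proof.
move=> mf ig fg; apply: (le_integrable measurableT _ _ ig) => //.
  exact/measurable_EFinP.
by move=> x _; rewrite /= lee_fin (le_trans (fg x))// ler_norm.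
Qed.

Lemma measurable_cos (R : realType) d (T : measurableType d) (f : T -> R) :
  measurable_fun setT f -> measurable_fun setT (fun x => cos (f x)).
Proof.
by apply: measurableT_comp; apply: continuous_measurable_fun; exact: continuous_cos.
Qed.

Lemma measurable_sin (R : realType) d (T : measurableType d) (f : T -> R) :
  measurable_fun setT f -> measurable_fun setT (fun x => sin (f x)).
Proof.
by apply: measurableT_comp; apply: continuous_measurable_fun; exact: continuous_sin.
Qed.

(** * Square norms against a positive kernel *)

Section bessel.
Context d1 d2 (X : measurableType d1) (Y : measurableType d2) (R : realType).
Variables (mu : {sigma_finite_measure set X -> \bar R})
  (nu : {sigma_finite_measure set Y -> \bar R}).
Variables (phi : X * Y -> R) (u v : X -> R) (W : Y -> R) (K : X -> X -> R)
  (M : R).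
Hypotheses (mphi : measurable_fun setT phi)
  (iu : mu.-integrable setT (EFin \o u)) (iv : mu.-integrable setT (EFin \o v))
  (W_ge0 : forall s, 0 <= W s) (iW : nu.-integrable setT (EFin \o W))
  (K_ge0 : forall x y, 0 <= K x y)
  (mK : measurable_fun setT (fun z : X * X => K z.1 z.2))
  (K_cos : forall x y,
    \int[nu]_s (W s * cos (phi (x, s) - phi (y, s))) = K x y)
  (K_sin : forall x y,
    \int[nu]_s (W s * sin (phi (x, s) - phi (y, s))) = 0)
  (M_ge0 : 0 <= M)
  (K_le : forall x, (\int[mu]_y (K x y)%:E <= M%:E)%E).

(** With g = u + i v, [e] and [o] are the real and imaginary parts of g(x) exp(i phi(x, s)); [N] is
    |g|^2, and [G] is an integrable majorant of both parts, uniform in s. *)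
Let e x s : R := u x * cos (phi (x, s)) - v x * sin (phi (x, s)).
Let o x s : R := u x * sin (phi (x, s)) + v x * cos (phi (x, s)).
Let N x : R := u x ^+ 2 + v x ^+ 2.
Let G x : R := `|u x| + `|v x|.

Let mu_ : measurable_fun setT u.
Proof. by move/integrableP : iu => [/measurable_EFinP]. Qed.

Let mv : measurable_fun setT v.
Proof. by move/integrableP : iv => [/measurable_EFinP]. Qed.

Let mW : measurable_fun setT W.
Proof. by move/integrableP : iW => [/measurable_EFinP]. Qed.

Let iG : mu.-integrable setT (EFin \o G).
Proof.
exact: (integrableD measurableT (integrable_norm iu) (integrable_norm iv)).
Qed.

Let G_ge0 x : 0 <= G x. Proof. by rewrite addr_ge0. Qed.

Let eG x s : `|e x s| <= G x.
Proof.
rewrite (le_trans (ler_normB _ _))// !normrM lerD// ler_piMr//.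
  by rewrite ler_norml cos_geN1 cos_le1.
by rewrite ler_norml sin_geN1 sin_le1.
Qed.

Let oG x s : `|o x s| <= G x.
Proof.
rewrite (le_trans (ler_normD _ _))// !normrM lerD// ler_piMr//.
  by rewrite ler_norml sin_geN1 sin_le1.
by rewrite ler_norml cos_geN1 cos_le1.
Qed.

Let me : measurable_fun setT (fun z : X * Y => e z.1 z.2).
Proof.
have mp : measurable_fun setT (fun z : X * Y => phi (z.1, z.2)).
  by under eq_fun do rewrite -surjective_pairing.
apply: measurable_funB; apply: measurable_funM.
- exact: (measurableT_comp mu_ measurable_fst).
- exact: measurable_cos.
- exact: (measurableT_comp mv measurable_fst).
- exact: measurable_sin.
Qed.

Let mo : measurable_fun setT (fun z : X * Y => o z.1 z.2).
Proof.
have mp : measurable_fun setT (fun z : X * Y => phi (z.1, z.2)).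
  by under eq_fun do rewrite -surjective_pairing.
apply: measurable_funD; apply: measurable_funM.
- exact: (measurableT_comp mu_ measurable_fst).
- exact: measurable_sin.
- exact: (measurableT_comp mv measurable_fst).
- exact: measurable_cos.
Qed.

Let ie s : mu.-integrable setT (EFin \o e^~ s).
Proof.
apply: integrable_le iG _ => // ; exact: (measurableT_comp me (measurable_pair2 s)).
Qed.

Let io s : mu.-integrable setT (EFin \o o^~ s).
Proof.
apply: integrable_le iG _ => // ; exact: (measurableT_comp mo (measurable_pair2 s)).
Qed.

Let mm : {sigma_finite_measure set (X * X)%type -> \bar R} :=
  sigma_finite_prod mu mu.

Let H (z : (X * X) * Y) : R :=
  W z.2 * (e z.1.1 z.2 * e z.1.2 z.2 + o z.1.1 z.2 * o z.1.2 z.2).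

(** A product of two integrals over X is one integral over X x X; in this form Fubini can move the
    integration in s inside. *)
Let squares s :
  (W s * ((\int[mu]_x e x s) ^+ 2 + (\int[mu]_x o x s) ^+ 2))%:E =
  (\int[(mu \x mu)]_z (H (z, s))%:E)%E.
Proof.
rewrite expr2 -Rintegral_prod// expr2 -Rintegral_prod//.
have iee := integrable_prod (ie s) (ie s).
have ioo := integrable_prod (io s) (io s).
rewrite EFinM EFinD !fineK ?integrable_fin_num//.
rewrite -integralD// -integralZl//.
by apply: integrableD.
Qed.

Let mfst2 T (mT : measurableType T) (f : X * Y -> mT) : measurable_fun setT f ->
  measurable_fun setT (fun z : (X * X) * Y => f (z.1.1, z.2)).
Proof.
move=> mf; apply: (measurableT_comp mf); apply: measurable_fun_pair => //.
exact: (measurableT_comp measurable_fst measurable_fst).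
Qed.

Let msnd2 T (mT : measurableType T) (f : X * Y -> mT) : measurable_fun setT f ->
  measurable_fun setT (fun z : (X * X) * Y => f (z.1.2, z.2)).
Proof.
move=> mf; apply: (measurableT_comp mf); apply: measurable_fun_pair => //.
exact: (measurableT_comp measurable_snd measurable_fst).
Qed.

(** The majorant 2 G(x) G(y) W(s) gives the absolute integrability that Fubini requires;
    integrability of [u], [v] and [W] enters here. *)
Let iH : (mm \x nu)%E.-integrable setT (EFin \o H).
Proof.
have iGG := integrable_prod iG iG.
have iGGW := integrable_prod (mu := mm) iGG iW.
have iGGW2 := integrableZl measurableT 2 iGGW.
apply: (integrable_le _ iGGW2).
  apply: measurable_funM; first exact: (measurableT_comp mW measurable_snd).
  apply: measurable_funD; apply: measurable_funM.
  - exact: (mfst2 me).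
  - exact: (msnd2 me).
  - exact: (mfst2 mo).
  - exact: (msnd2 mo).
move=> [[x y] s] /=.
rewrite /H/= normrM (ger0_norm (W_ge0 _)) mulrA mulrC ler_wpM2r//.
rewrite mulr_natl mulr2n (le_trans (ler_normD _ _))// !normrM.
by rewrite lerD// ler_pM.
Qed.

(** The integrand is W times the real part of g(x) conj(g(y)) exp(i (phi(x, s) - phi(y, s))), that
    is P cos + Q sin of the phase difference, and the sine part integrates to 0. *)
Let HE x y :
  (\int[nu]_s (H ((x, y), s))%:E)%E = ((u x * u y + v x * v y) * K x y)%:E.
Proof.
have ic : nu.-integrable setT
    (EFin \o (fun s => W s * cos (phi (x, s) - phi (y, s)))).
  apply: integrable_le iW _.
    apply: measurable_funM => //; apply: measurable_cos; apply: measurable_funB.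
      exact: (measurableT_comp mphi (measurable_pair1 x)).
    exact: (measurableT_comp mphi (measurable_pair1 y)).
  move=> s; rewrite normrM (ger0_norm (W_ge0 _)) ler_piMr//.
  by rewrite ler_norml cos_geN1 cos_le1.
have isn : nu.-integrable setT
    (EFin \o (fun s => W s * sin (phi (x, s) - phi (y, s)))).
  apply: integrable_le iW _.
    apply: measurable_funM => //; apply: measurable_sin; apply: measurable_funB.
      exact: (measurableT_comp mphi (measurable_pair1 x)).
    exact: (measurableT_comp mphi (measurable_pair1 y)).
  move=> s; rewrite normrM (ger0_norm (W_ge0 _)) ler_piMr//.
  by rewrite ler_norml sin_geN1 sin_le1.
set P := (_ + _); pose Q := u x * v y - v x * u y.
transitivity (\int[nu]_s ((P%:E * (W s * cos (phi (x, s) - phi (y, s)))%:E) +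
    (Q%:E * (W s * sin (phi (x, s) - phi (y, s)))%:E)))%E.
  apply: eq_integral => s _; rewrite -!EFinM -EFinD; congr EFin.
  by rewrite /H /e /o /P /Q /= cosB sinB; ring.
rewrite integralD//; [|exact: integrableZl|exact: integrableZl].
rewrite !integralZl//.
have -> : (\int[nu]_s (W s * cos (phi (x, s) - phi (y, s)))%:E = (K x y)%:E)%E.
  by rewrite -K_cos /Rintegral fineK// integrable_fin_num.
have -> : (\int[nu]_s (W s * sin (phi (x, s) - phi (y, s)))%:E = 0%:E)%E.
  by rewrite -(K_sin x y) /Rintegral fineK// integrable_fin_num.
by rewrite mule0 adde0.
Qed.

Let K_sym x y : K x y = K y x.
Proof.
rewrite -!K_cos; apply: eq_Rintegral => s _.
by rewrite -cosN opprB.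
Qed.

Let mN : measurable_fun setT N.
Proof. by apply: measurable_funD; exact: measurable_funX. Qed.

Let N_ge0 x : 0 <= N x. Proof. by rewrite addr_ge0// sqr_ge0. Qed.

Let NK : (\int[mu \x mu]_z (N z.1 * K z.1 z.2)%:E <= M%:E * \int[mu]_x (N x)%:E)%E.
Proof.
rewrite fubini_tonelli1//=; last 2 first.
- apply/measurable_EFinP/measurable_funM => //.
  exact: (measurableT_comp mN measurable_fst).
- by move=> z; rewrite lee_fin mulr_ge0.
rewrite -ge0_integralZl//; last 2 first.
- exact/measurable_EFinP.
- by move=> x _; rewrite lee_fin.
apply: le_integral_nonneg => x.
  by apply: integral_ge0 => y _; rewrite lee_fin mulr_ge0.
rewrite /fubini_F/=; under eq_integral do rewrite EFinM.
rewrite ge0_integralZl//; last 3 first.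
- apply/measurable_EFinP.
  exact: (measurableT_comp mK (measurable_pair1 x)).
- by move=> y _; rewrite lee_fin.
- by rewrite lee_fin.
by rewrite muleC lee_wpmul2r// lee_fin.
Qed.

(** This is Schur's test: |Re (g(x) conj(g(y)))| <= (N(x) + N(y)) / 2, the two halves contribute
    equally because K is symmetric, and each is controlled by the mass bound [M]. *)
Lemma bessel_kernel :
  (\int[nu]_s (W s * ((\int[mu]_x e x s) ^+ 2 + (\int[mu]_x o x s) ^+ 2))%:E
   <= M%:E * \int[mu]_x (N x)%:E)%E.
Proof.
under eq_integral do rewrite squares.
rewrite -(Fubini iH)/=.
rewrite (eq_integral (fun z : X * X =>
    ((u z.1 * u z.2 + v z.1 * v z.2) * K z.1 z.2)%:E)); last first.
  by move=> [x y] _; exact: HE.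
have mNK : measurable_fun setT (fun z : X * X => (N z.1 * K z.1 z.2)%:E).
  apply/measurable_EFinP/measurable_funM => //.
  exact: (measurableT_comp mN measurable_fst).
have mKN : measurable_fun setT (fun z : X * X => (N z.2 * K z.1 z.2)%:E).
  apply/measurable_EFinP/measurable_funM => //.
  exact: (measurableT_comp mN measurable_snd).
have KN : (\int[mu \x mu]_z (N z.2 * K z.1 z.2)%:E =
           \int[mu \x mu]_z (N z.1 * K z.1 z.2)%:E)%E.
  rewrite fubini_tonelli2//=; last by move=> z; rewrite lee_fin mulr_ge0.
  rewrite fubini_tonelli1//=; last by move=> z; rewrite lee_fin mulr_ge0.
  by apply: eq_integral => x _; apply: eq_integral => y _ /=; rewrite K_sym.
have h0 : (0 <= (2^-1)%:E :> \bar R)%E by rewrite lee_fin.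
apply: (@le_trans _ _ ((2^-1)%:E * (\int[mu \x mu]_z (N z.1 * K z.1 z.2)%:E +
                        \int[mu \x mu]_z (N z.2 * K z.1 z.2)%:E))%E).
  rewrite -ge0_integralD//; last 2 first.
  - by move=> z _; rewrite lee_fin mulr_ge0.
  - by move=> z _; rewrite lee_fin mulr_ge0.
  rewrite -ge0_integralZl//; last 2 first.
  - exact: emeasurable_funD.
  - by move=> z _; rewrite adde_ge0// lee_fin mulr_ge0.
  apply: (le_trans (lee_abs _)).
  have mP : measurable_fun setT (fun z : X * X =>
      ((u z.1 * u z.2 + v z.1 * v z.2) * K z.1 z.2)%:E).
    apply/measurable_EFinP; apply: measurable_funM => //.
    apply: measurable_funD; apply: measurable_funM.
    - exact: (measurableT_comp mu_ measurable_fst).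
    - exact: (measurableT_comp mu_ measurable_snd).
    - exact: (measurableT_comp mv measurable_fst).
    - exact: (measurableT_comp mv measurable_snd).
  apply: (le_trans (le_abse_integral _ _ mP)) => //.
  apply: le_integral_nonneg => //= -[x y] /=.
  rewrite -EFinD -EFinM lee_fin normrM (ger0_norm (K_ge0 _ _)) -mulrDl mulrA.
  apply: ler_wpM2r => //; rewrite /N ler_norml.
  have := sqr_ge0 (u x - u y); have := sqr_ge0 (v x - v y).
  have := sqr_ge0 (u x + u y); have := sqr_ge0 (v x + v y).
  by rewrite !sqrrD !sqrrN => *; apply/andP; split; lra.
rewrite KN -mule2n -mule_natl muleA -EFinM mulVf// mul1e.
exact: NK.
Qed.
End bessel.

(** * The Poisson kernel on the line *)

Section poisson_kernel.
Context {R : realType}.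
Let mu := @lebesgue_measure R.
Implicit Types e x s : R.

Definition laplace_weight e s : R := expR (- (e * `|s|)).

Definition poisson_kernel e x : R := 2 * e / (e ^+ 2 + x ^+ 2).

Lemma laplace_weight_ge0 e s : 0 <= laplace_weight e s.
Proof. exact: expR_ge0. Qed.

Lemma poisson_kernel_ge0 e x : 0 <= e -> 0 <= poisson_kernel e x.
Proof.
by move=> e0; rewrite /poisson_kernel divr_ge0// ?mulr_ge0// addr_ge0// sqr_ge0.
Qed.

Lemma continuous_laplace_weight e : continuous (laplace_weight e).
Proof.
move=> s; apply: (@continuous_comp _ _ _ (fun s : R => - (e * `|s|)) expR).
  by apply: cvgN; apply: cvgM; [exact: cvg_cst|exact: norm_continuous].
exact: continuous_expR.
Qed.

Lemma continuous_poisson_kernel e : 0 < e -> continuous (poisson_kernel e).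
Proof.
move=> e0 x; apply: cvgM; first exact: cvg_cst.
apply: cvgV; first by rewrite gt_eqF// ltr_pwDl ?exprn_gt0// sqr_ge0.
by apply: cvgD; [exact: cvg_cst|exact: exprn_continuous].
Qed.

Let den e x : 0 < e -> e ^+ 2 + x ^+ 2 != 0.
Proof. by move=> e0; rewrite gt_eqF// ltr_pwDl ?exprn_gt0// sqr_ge0. Qed.

Let cosx x : continuous (fun s => cos (x * s)).
Proof.
move=> s; apply: (@continuous_comp _ _ _ (fun s : R => x * s) cos).
  exact: mulrl_continuous.
exact: continuous_cos.
Qed.

(** An antiderivative of exp(- e s) (1 + cos (x s)). Adding 1 makes the integrand nonnegative, as
    [ge0_continuous_FTC2y] asks on the half-line, and accounts for the term - 1 / e. *)
Let primitive e x s : R :=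
  expR (- (e * s)) *
  ((x * sin (x * s) - e * cos (x * s)) / (e ^+ 2 + x ^+ 2) - e^-1).

Let primitive_derive e x s : 0 < e ->
  is_derive s 1 (primitive e x) (expR (- (e * s)) * (1 + cos (x * s))).
Proof.
move=> e0; rewrite /primitive; apply: is_derive_eq.
rewrite /GRing.scale /=.
have := den x e0; have : e != 0 by rewrite gt_eqF.
by move=> *; field; apply/andP.
Qed.

Let primitive_cvg e x : 0 < e -> primitive e x s @[s --> +oo] --> 0.
Proof.
move=> e0.
have cvge : expR (- (e * s)) @[s --> +oo] --> 0.
  apply: (@cvg_comp _ _ _ (fun s => e * s) (fun s => expR (- s))).
    apply: gt0_cvgMry => //; exact: cvg_id.
  exact: cvgr_expR.
pose C := (`|x| + e) / (e ^+ 2 + x ^+ 2) + e^-1.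
apply/cvgr0Pnorm_le => d d0.
have : expR (- (e * s)) * C @[s --> +oo] --> 0 by
    by rewrite -(mul0r C); apply: cvgM => //; exact: cvg_cst.
move/cvgr0Pnorm_le => /(_ _ d0); apply: filterS => s.
apply: le_trans; rewrite !normrM ler_wpM2l//.
rewrite (le_trans (ler_normB _ _))//.
have C1 : 0 <= (`|x| + e) / (e ^+ 2 + x ^+ 2).
  by rewrite divr_ge0// ?addr_ge0 ?sqr_ge0// ltW.
rewrite [leRHS]ger0_norm ?addr_ge0 ?invr_ge0 ?(ltW e0)//.
rewrite [X in _ + X]ger0_norm ?invr_ge0 ?(ltW e0)// lerD2r.
rewrite normrM normfV [X in _ / X]ger0_norm ?addr_ge0 ?sqr_ge0//.
rewrite ler_wpM2r ?invr_ge0 ?addr_ge0 ?sqr_ge0//.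
rewrite (le_trans (ler_normB _ _))// !normrM lerD//.
  by rewrite ler_piMr// ler_norml sin_geN1 sin_le1.
rewrite (gtr0_norm e0) ler_piMr ?(ltW e0)//.
by rewrite ler_norml cos_geN1 cos_le1.
Qed.

Let integral_laplace_1cos e x : 0 < e ->
  (\int[mu]_s (laplace_weight e s * (1 + cos (x * s)))%:E =
   (2 * (e^-1 + e / (e ^+ 2 + x ^+ 2)))%:E)%E.
Proof.
move=> e0.
have cf : continuous (fun s => laplace_weight e s * (1 + cos (x * s))).
  move=> s; apply: cvgM; first exact: continuous_laplace_weight.
  by apply: cvgD; [exact: cvg_cst|exact: cosx].
have f0 s : 0 <= laplace_weight e s * (1 + cos (x * s)).
  by rewrite mulr_ge0 ?laplace_weight_ge0// -lerBlDl sub0r cos_geN1.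
rewrite ge0_symfun_integralT//; last first.
  by move=> s /=; rewrite /laplace_weight normrN mulrN cosN.
rewrite EFinM; congr (_ * _)%E.
rewrite -set_itvcy.
have cp s : {for s, continuous (primitive e x)}.
  apply/differentiable_continuous/derivable1_diffP.
  by case: (primitive_derive x s e0).
rewrite (@ge0_continuous_FTC2y R _ (primitive e x) 0 0)//.
- rewrite /primitive !mulr0 oppr0 expR0 sin0 cos0 mulr0 sub0r mul1r mulr1.
  by rewrite -EFinB; congr EFin; rewrite sub0r opprB mulNr opprK.
- exact: continuous_subspaceT.
- exact: primitive_cvg.
- by apply: cvg_at_right_filter; exact: cp.
- move=> s; rewrite in_itv/= andbT => s0.
  rewrite derive1E; case: (primitive_derive x s e0) => _ ->.
  by rewrite /laplace_weight gtr0_norm.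
Qed.

Lemma integrable_laplace_weight e : 0 < e ->
  mu.-integrable setT (EFin \o laplace_weight e).
Proof.
move=> e0; apply/integrableP; split.
  apply/measurable_EFinP; apply: continuous_measurable_fun.
  exact: continuous_laplace_weight.
have := integral_laplace_1cos 0 e0.
under eq_integral do rewrite mul0r cos0.
move=> h; apply: (@le_lt_trans _ _
  (\int[mu]_s (laplace_weight e s * (1 + 1))%:E)%E); last first.
  by rewrite h ltry.
apply: le_integral_nonneg => //= s.
rewrite lee_fin ger0_norm ?laplace_weight_ge0// ler_peMr ?laplace_weight_ge0//.
by rewrite lerDl.
Qed.

Let integrable_laplace_bounded e (f : R -> R) : 0 < e -> continuous f ->
  (forall s, `|f s| <= 1) ->
  mu.-integrable setT (EFin \o (fun s => laplace_weight e s * f s)).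
Proof.
move=> e0 cf f1; apply: (integrable_le _ (integrable_laplace_weight e0)).
  apply: measurable_funM; apply: continuous_measurable_fun => //.
  exact: continuous_laplace_weight.
move=> s; rewrite normrM ger0_norm ?laplace_weight_ge0//.
by rewrite ler_piMr ?laplace_weight_ge0.
Qed.

Lemma integrable_laplace_cos e x : 0 < e ->
  mu.-integrable setT (EFin \o (fun s => laplace_weight e s * cos (x * s))).
Proof.
move=> e0; apply: integrable_laplace_bounded => // s.
by rewrite ler_norml cos_geN1 cos_le1.
Qed.

Lemma integrable_laplace_sin e x : 0 < e ->
  mu.-integrable setT (EFin \o (fun s => laplace_weight e s * sin (x * s))).
Proof.
move=> e0; apply: integrable_laplace_bounded => // s.
  apply: (@continuous_comp _ _ _ (fun s : R => x * s) sin).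
    exact: mulrl_continuous.
  exact: continuous_sin.
by rewrite ler_norml sin_geN1 sin_le1.
Qed.

Lemma Rintegral_laplace_cos e x : 0 < e ->
  \int[mu]_s (laplace_weight e s * cos (x * s)) = poisson_kernel e x.
Proof.
move=> e0.
have I1 y : (\int[mu]_s (laplace_weight e s)) +
    (\int[mu]_s (laplace_weight e s * cos (y * s))) =
    2 * (e^-1 + e / (e ^+ 2 + y ^+ 2)).
  rewrite -RintegralD//; last 2 first.
  - exact: integrable_laplace_weight.
  - exact: integrable_laplace_cos.
  rewrite -[RHS]/(fine (_%:E)) -integral_laplace_1cos// /Rintegral; congr fine.
  by apply: eq_integral => s _; rewrite mulrDr mulr1.
(* At y = 0 the cosine is 1, so the identity reads A + A = 4 / e and determines the integral A of
   the weight alone; subtracting A at y = x isolates the cosine integral. *)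
have I0 := I1 0; move: I0 (I1 x).
under [X in _ + X = _ -> _]eq_Rintegral do rewrite mul0r cos0 mulr1.
set A := (\int[_]_s _); set B := (\int[_]_s _) => h1 h2.
have e0' : e != 0 by rewrite gt_eqF.
have hA : A = 2 / e.
  have : A + A = 2 * (2 / e) by rewrite h1; field.
  by lra.
have -> : B = 2 * (e^-1 + e / (e ^+ 2 + x ^+ 2)) - A by rewrite -h2 addrC addKr.
by rewrite hA /poisson_kernel; have := den x e0 => d; field; apply/andP.
Qed.

(** The integrand is odd: transport along s -> -s, which preserves Lebesgue measure, shows that the
    integral equals its own opposite. *)
Lemma Rintegral_laplace_sin e x : 0 < e ->
  \int[mu]_s (laplace_weight e s * sin (x * s)) = 0.
Proof.
move=> e0; set f := (fun s => laplace_weight e s * sin (x * s)).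
have intf := integrable_laplace_sin x e0.
have mf : measurable_fun [set: measurableTypeR R] (EFin \o f).
  exact: (measurable_int _ intf).
have mopp : measurable_fun [set: measurableTypeR R] (-%R : _ -> measurableTypeR R).
  exact: oppr_measurable.
have fN s : f (- s) = - f s by rewrite /f /laplace_weight normrN mulrN sinN mulrN.
suff : (\int[mu]_s (f s)%:E = - \int[mu]_s (f s)%:E)%E.
  rewrite /Rintegral -(fineK (integrable_fin_num measurableT intf)) -EFinN => -[] /=.
  by move=> h; lra.
rewrite -integralN; last exact: integrable_add_def.
transitivity (\int[pushforward mu (-%R : _ -> measurableTypeR R)]_s (f s)%:E)%E.
  by apply: eq_measure_integral => A mA _ /=; rewrite lebesgue_measureN.
rewrite [LHS](@integral_pushforward _ _ (measurableTypeR R) (measurableTypeR R)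
  R _ mopp mu setT _ mf)//=.
- by rewrite preimage_setT; apply: eq_integral => s _ /=; rewrite fN.
- rewrite preimage_setT (_ : _ \o _ = (\- (EFin \o f))%E); last first.
    by apply/funext => s /=; rewrite fN.
  exact: integrableN.
Qed.

(** The substitution s = (y - x) / e turns the kernel into 2 / (1 + s^2), so its mass does not
    depend on [e] or [x]. *)
Lemma integral_poisson_kernel e x : 0 < e ->
  (\int[mu]_y (poisson_kernel e (x - y))%:E = (2 * pi)%:E)%E.
Proof.
move=> e0.
have e0' : e != 0 by rewrite gt_eqF.
have G0 s : 0 <= 2 * (oneDsqr s)^-1.
  by rewrite mulr_ge0// invr_ge0 (le_trans _ (oneDsqr_ge1 s)).
have cG : continuous (fun s : R => 2 * (oneDsqr s)^-1).
  by move=> s; apply: cvgM; [exact: cvg_cst|exact: continuous_oneDsqrV].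
have G2pi : (\int[mu]_s (2 * (oneDsqr s)^-1)%:E = (2 * pi)%:E)%E.
  rewrite ge0_symfun_integralT//; last by move=> s; rewrite /oneDsqr /= sqrrN.
  rewrite -set_itvcy; under eq_integral do rewrite EFinM.
  rewrite ge0_integralZl//; last first.
    apply/measurable_EFinP; apply: measurable_funTS.
    by apply: continuous_measurable_fun; exact: continuous_oneDsqrV.
  by rewrite integral0y_oneDsqr -!EFinM; congr EFin; field.
pose F y : R := e^-1 * (y - x).
have dF (y : R) : is_derive y (1 : R) F e^-1.
  by rewrite /F; apply: is_derive_eq; rewrite /GRing.scale /=; ring.
have F'E : derive1 F = cst e^-1.
  by apply/funext => y; rewrite derive1E; case: (dF y).
rewrite -G2pi [RHS](@increasing_ge0_integration_by_substitutionT _ F)//=.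
- apply: eq_integral => y _; congr EFin.
  rewrite !fctE F'E /F /poisson_kernel /oneDsqr/=.
  have -> : x - y = - (y - x) by rewrite opprB.
  have -> : 1 + (e^-1 * (y - x)) ^+ 2 = (e ^+ 2 + (- (y - x)) ^+ 2) / e ^+ 2.
    by field.
  have d := den (- (y - x)) e0.
  rewrite invf_div; field.
  by apply/andP.
- by move=> a b ab; rewrite /F ltr_pM2l ?invr_gt0// ltrD2r.
- by rewrite F'E; exact: cst_continuous.
- by rewrite F'E; exact: is_cvg_cst.
- by rewrite F'E; exact: is_cvg_cst.
- by apply: gt0_cvgMrNy; rewrite ?invr_gt0//; exact: cvg_addrr_Ny.
- by apply: gt0_cvgMry; rewrite ?invr_gt0//; exact: cvg_addrr.
Qed.
End poisson_kernel.

(** * The Laplace weight on R^n *)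

Section integral_Rn.
Context {R : realType}.
Let leb := @lebesgue_measure R.

Lemma ge0_integral_RnS n (f : Rn R n.+1 -> \bar R) :
  measurable_fun setT f -> (forall x, 0 <= f x)%E ->
  (\int[lebesgue_Rn n.+1]_x f x =
   \int[leb]_a \int[lebesgue_Rn n]_y f (cons_Rn (a, y)))%E.
Proof.
move=> mf f0.
rewrite [LHS](@ge0_integral_pushforward _ _ _ _ _ _ (@measurable_cons_Rn R n)
  (leb \x lebesgue_Rn n)%E setT f)//.
rewrite preimage_setT fubini_tonelli1//.
  exact: measurableT_comp (@measurable_cons_Rn R n).
by move=> z /=.
Qed.

Lemma integrable_RnS n (f : Rn R n.+1 -> R) (p : R -> R) (q : Rn R n -> R) :
  measurable_fun setT f -> (forall a y, f (cons_Rn (a, y)) = p a * q y) ->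
  leb.-integrable setT (EFin \o p) ->
  (lebesgue_Rn n).-integrable setT (EFin \o q) ->
  (lebesgue_Rn n.+1).-integrable setT (EFin \o f) /\
  \int[lebesgue_Rn n.+1]_x f x = (\int[leb]_a p a) * (\int[lebesgue_Rn n]_y q y).
Proof.
move=> mf fpq ip iq.
have mf' : measurable_fun setT (EFin \o f) by exact/measurable_EFinP.
have ipq := integrable_prod ip iq.
have fE : (EFin \o f) \o @cons_Rn R n = EFin \o (fun z => p z.1 * q z.2).
  by apply/funext => -[a y] /=; rewrite fpq.
have ifc : (leb \x lebesgue_Rn n)%E.-integrable
    (@cons_Rn R n @^-1` setT) ((EFin \o f) \o @cons_Rn R n).
  by rewrite preimage_setT fE.
split.
  exact: (integrable_pushforward (@measurable_cons_Rn R n) mf' ifc).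
rewrite -Rintegral_prod// /Rintegral; congr fine.
rewrite [LHS](@integral_pushforward _ _ _ _ _ _ (@measurable_cons_Rn R n)
  (leb \x lebesgue_Rn n)%E setT _ mf' ifc)//.
by rewrite preimage_setT fE.
Qed.

Lemma integrable_Rn0 (f : Rn R 0 -> R) :
  measurable_fun setT f ->
  (lebesgue_Rn 0).-integrable setT (EFin \o f) /\
  \int[lebesgue_Rn 0]_x f x = f [tuple].
Proof.
move=> mf; have mf' : measurable_fun setT (EFin \o f) by exact/measurable_EFinP.
split.
  apply/integrableP; split=> //.
  rewrite [ltLHS]integral_dirac//; last exact: measurableT_comp.
  by rewrite diracT mul1e ltry.
by rewrite /Rintegral [X in fine X]integral_dirac// diracT mul1e.
Qed.

End integral_Rn.

Section weight_Rn.
Context {R : realType}.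
Implicit Types (n : nat) (e : R).

Definition weight_Rn n e (xi : Rn R n) : R :=
  \prod_(i < n) laplace_weight e (tnth xi i).

(** The coefficients are a function on indices, so that deleting the first coordinate in an
    induction is precomposition with [lift ord0]. *)
Definition linear_Rn n (z : 'I_n -> R) (xi : Rn R n) : R :=
  \sum_(i < n) (tnth xi i : R) * z i.

Lemma weight_Rn_cons n e (a : R) (y : Rn R n) :
  weight_Rn e (cons_Rn (a, y)) = laplace_weight e a * weight_Rn e y.
Proof.
rewrite /weight_Rn big_ord_recl; congr (_ * _).
by apply: eq_bigr => i _; rewrite tnthS.
Qed.

Lemma linear_Rn_cons n z (a : R) (y : Rn R n) :
  linear_Rn z (cons_Rn (a, y)) =
  z ord0 * a + linear_Rn (fun i => z (lift ord0 i)) y.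
Proof.
rewrite /linear_Rn big_ord_recl mulrC; congr (_ + _).
by apply: eq_bigr => i _; rewrite tnthS.
Qed.

Lemma measurable_weight_Rn n e : measurable_fun setT (@weight_Rn n e).
Proof.
apply: measurable_prod => i _.
apply: (@measurableT_comp _ _ _ _ _ _ (laplace_weight e)) => //.
  by apply: continuous_measurable_fun; exact: continuous_laplace_weight.
exact: measurable_tnth.
Qed.

Lemma measurable_linear_Rn n z : measurable_fun setT (@linear_Rn n z).
Proof.
apply: measurable_sum => i; apply: measurable_funM => //.
exact: measurable_tnth.
Qed.

Lemma integrable_weight_Rn n e : 0 < e ->
  (lebesgue_Rn n).-integrable setT (EFin \o @weight_Rn n e).
Proof.
move=> e0; elim: n => [|n ih].
  by case: (integrable_Rn0 (@measurable_weight_Rn 0 e)).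
by case: (integrable_RnS (@measurable_weight_Rn n.+1 e) (@weight_Rn_cons n e)
  (integrable_laplace_weight e0) ih).
Qed.

(** The four claims go through one induction because the addition formulas, applied to first
    coordinate plus rest, mix cosine and sine. Each resulting term separates into an integral on the
    line times one over the tail; every term with a sine factor vanishes. *)
Lemma integral_weight_trig n e (z : 'I_n -> R) : 0 < e ->
  [/\ (lebesgue_Rn n).-integrable setT
        (EFin \o (fun xi => weight_Rn e xi * cos (linear_Rn z xi))),
      (lebesgue_Rn n).-integrable setT
        (EFin \o (fun xi => weight_Rn e xi * sin (linear_Rn z xi))),
      \int[lebesgue_Rn n]_xi (weight_Rn e xi * cos (linear_Rn z xi)) =
        \prod_(i < n) poisson_kernel e (z i) &
      \int[lebesgue_Rn n]_xi (weight_Rn e xi * sin (linear_Rn z xi)) = 0].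
Proof.
move=> e0; have mc m (y : 'I_m -> R) : measurable_fun setT
    (fun xi => weight_Rn e xi * cos (linear_Rn y xi)).
  apply: measurable_funM; first exact: measurable_weight_Rn.
  by apply: measurable_cos; exact: measurable_linear_Rn.
have ms m (y : 'I_m -> R) : measurable_fun setT
    (fun xi => weight_Rn e xi * sin (linear_Rn y xi)).
  apply: measurable_funM; first exact: measurable_weight_Rn.
  by apply: measurable_sin; exact: measurable_linear_Rn.
elim: n z => [|n ih] z.
  have [ic ->] := integrable_Rn0 (mc _ z).
  have [isn ->] := integrable_Rn0 (ms _ z).
  by split=> //; rewrite /weight_Rn /linear_Rn !big_ord0 ?cos0 ?sin0 ?mulr1 ?mulr0.
have [ic isn Ic Is] := ih (fun i => z (lift ord0 i)).
set z' := fun i => z (lift ord0 i) in ic isn Ic Is.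
(* The products cos cos, sin sin, cos sin and sin cos are treated uniformly; writing [xi] as head
   and tail gives the separated form that [integrable_RnS] expects. *)
have mz (h1 h2 : R -> R) : continuous h1 -> continuous h2 ->
  measurable_fun setT (fun xi : Rn R n.+1 => weight_Rn e xi *
    (h1 (z ord0 * tnth xi ord0) * h2 (linear_Rn z' [tuple of behead xi]))).
  move=> c1 c2; apply: measurable_funM; first exact: measurable_weight_Rn.
  apply: measurable_funM.
    apply: (@measurableT_comp _ _ _ _ _ _ h1).
      exact: continuous_measurable_fun.
    by apply: measurable_funM => //; exact: measurable_tnth.
  apply: (@measurableT_comp _ _ _ _ _ _ h2).
    exact: continuous_measurable_fun.
  by apply: (measurableT_comp (measurable_linear_Rn z')); exact: measurable_behead.
have step (h1 h2 : R -> R) a (y : Rn R n) : weight_Rn e (cons_Rn (a, y)) *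
    (h1 (z ord0 * tnth (cons_Rn (a, y)) ord0) *
     h2 (linear_Rn z' [tuple of behead (cons_Rn (a, y))])) =
   (laplace_weight e a * h1 (z ord0 * a)) * (weight_Rn e y * h2 (linear_Rn z' y)).
  rewrite weight_Rn_cons mulrACA; congr (_ * (_ * h2 (linear_Rn z' _))).
  exact: val_inj.
have lc := integrable_laplace_cos (z ord0) e0.
have ls := integrable_laplace_sin (z ord0) e0.
have cs := @continuous_sin R; have cc := @continuous_cos R.
have [icc Icc] := integrable_RnS (mz cos cos cc cc) (step cos cos) lc ic.
have [iss Iss] := integrable_RnS (mz sin sin cs cs) (step sin sin) ls isn.
have [ics Ics] := integrable_RnS (mz cos sin cc cs) (step cos sin) lc isn.
have [isc Isc] := integrable_RnS (mz sin cos cs cc) (step sin cos) ls ic.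
have linE (xi : Rn R n.+1) : linear_Rn z xi =
    z ord0 * tnth xi ord0 + linear_Rn z' [tuple of behead xi].
  rewrite {1}(tuple_eta xi) -[RHS](linear_Rn_cons z (thead xi) [tuple of behead xi]).
  by [].
have cosE : (fun xi : Rn R n.+1 => weight_Rn e xi * cos (linear_Rn z xi)) =
  (fun xi => weight_Rn e xi * (cos (z ord0 * tnth xi ord0) *
     cos (linear_Rn z' [tuple of behead xi])) - weight_Rn e xi *
     (sin (z ord0 * tnth xi ord0) * sin (linear_Rn z' [tuple of behead xi]))).
  by apply/funext => xi; rewrite linE cosD mulrBr.
have sinE : (fun xi : Rn R n.+1 => weight_Rn e xi * sin (linear_Rn z xi)) =
  (fun xi => weight_Rn e xi * (sin (z ord0 * tnth xi ord0) *
     cos (linear_Rn z' [tuple of behead xi])) + weight_Rn e xi *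
     (cos (z ord0 * tnth xi ord0) * sin (linear_Rn z' [tuple of behead xi]))).
  by apply/funext => xi; rewrite linE sinD mulrDr.
split.
- by rewrite cosE; apply: (integrableB measurableT icc iss).
- by rewrite sinE; apply: (integrableD measurableT isc ics).
- rewrite cosE RintegralB// Icc Iss Ic Is mulr0 subr0 Rintegral_laplace_cos//.
  by rewrite big_ord_recl.
- by rewrite sinE RintegralD// Isc Ics Is Rintegral_laplace_sin// mul0r mulr0 addr0.
Qed.

(** By Tonelli each coordinate contributes 2 pi. This total mass is the constant [M] with which
    [bessel_kernel] is applied. *)
Lemma integral_poisson_Rn n e (z : 'I_n -> R) : 0 < e ->
  (\int[lebesgue_Rn n]_x (\prod_(i < n) poisson_kernel e (z i - tnth x i))%:E =
   ((2 * pi) ^+ n)%:E)%E.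
Proof.
move=> e0.
have mk m (w : 'I_m -> R) : measurable_fun setT
    (fun x : Rn R m => \prod_(i < m) poisson_kernel e (w i - tnth x i)).
  apply: measurable_prod => i _.
  apply: (@measurableT_comp _ _ _ _ _ _ (poisson_kernel e)).
    by apply: continuous_measurable_fun; exact: continuous_poisson_kernel.
  by apply: measurable_funB => //; exact: measurable_tnth.
elim: n z => [|n ih] z.
  rewrite [LHS]integral_dirac//; last by apply/measurable_EFinP; exact: (mk 0%N z).
  by rewrite diracT mul1e big_ord0 expr0.
rewrite ge0_integral_RnS; last 2 first.
- by apply/measurable_EFinP; exact: (mk n.+1 z).
- move=> x; rewrite lee_fin; apply: prodr_ge0 => i _.
  by rewrite poisson_kernel_ge0// ltW.
have inner a : (\int[lebesgue_Rn n]_y (\prod_(i < n.+1)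
      poisson_kernel e (z i - tnth (cons_Rn (a, y)) i))%:E =
    (poisson_kernel e (z ord0 - a))%:E * ((2 * pi) ^+ n)%:E)%E.
  rewrite -(ih (fun i => z (lift ord0 i))) -ge0_integralZl//; last 3 first.
  - by apply/measurable_EFinP; exact: (mk n (fun i => z (lift ord0 i))).
  - move=> x _; rewrite lee_fin; apply: prodr_ge0 => i _.
    by rewrite poisson_kernel_ge0// ltW.
  - by rewrite lee_fin poisson_kernel_ge0// ltW.
  apply: eq_integral => y _; rewrite big_ord_recl -EFinM; congr (_ * _)%:E.
  by apply: eq_bigr => i _; rewrite tnthS.
under eq_integral do rewrite inner.
rewrite ge0_integralZr//; last 3 first.
- apply/measurable_EFinP.
  apply: (@measurableT_comp _ _ _ _ _ _ (poisson_kernel e)).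
    by apply: continuous_measurable_fun; exact: continuous_poisson_kernel.
  exact: measurable_funB.
- by move=> x _; rewrite lee_fin poisson_kernel_ge0// ltW.
- by rewrite lee_fin exprn_ge0// mulr_ge0// pi_ge0.
by rewrite integral_poisson_kernel// -EFinM -exprS.
Qed.

End weight_Rn.

(** * The Plancherel inequality *)

Section plancherel.
Context {R : realType}.
Implicit Types (n : nat) (e c theta : R).

Lemma sqr_normc (z : R[i]) :
  Normc.normc z ^+ 2 = complex.Re z ^+ 2 + complex.Im z ^+ 2.
Proof. by case: z => a b /=; rewrite sqr_sqrtr// addr_ge0// sqr_ge0. Qed.

Lemma Re_expiM theta (z : R[i]) : complex.Re (expi theta * z) =
  complex.Re z * cos theta - complex.Im z * sin theta.
Proof. by case: z => a b /=; ring. Qed.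

Lemma Im_expiM theta (z : R[i]) : complex.Im (expi theta * z) =
  complex.Re z * sin theta + complex.Im z * cos theta.
Proof. by case: z => a b /=; ring. Qed.

Lemma measurable_dotp n d (T : measurableType d) (f g : T -> Rn R n) :
  measurable_fun setT f -> measurable_fun setT g ->
  measurable_fun setT (fun z => dotp (f z) (g z)).
Proof.
move=> mf mg; apply: measurable_sum => i; apply: measurable_funM.
  exact: (measurableT_comp (measurable_tnth i) mf).
exact: (measurableT_comp (measurable_tnth i) mg).
Qed.

Let cvg_weight_Rn n (xi : Rn R n) :
  weight_Rn k.+1%:R^-1 xi @[k --> \oo] --> (1 : R).
Proof.
pose S := \sum_(i < n) `|tnth xi i : R|.
have wE e : weight_Rn e xi = expR (- (e * S)).
  rewrite /weight_Rn /laplace_weight -expR_sum; congr expR.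
  by rewrite sumrN mulr_sumr.
under eq_fun do rewrite wE.
suff : expR (- (k.+1%:R^-1 * S)) @[k --> \oo] --> expR (- (0 * S)).
  by rewrite mul0r oppr0 expR0.
apply: continuous_cvg; first exact: continuous_expR.
apply: cvgN; apply: cvgM; last exact: cvg_cst.
exact: (@cvg_harmonic R).
Qed.

(** Monotonicity allows the weight to be removed by monotone convergence, with no prior knowledge
    that the transform is square integrable. *)
Let nd_weight_Rn n (xi : Rn R n) :
  {homo (fun k => weight_Rn (k.+1%:R^-1 : R) xi) : a b / (a <= b)%N >-> a <= b}.
Proof.
move=> a b ab; apply: ler_prod => i _; rewrite laplace_weight_ge0/=.
rewrite /laplace_weight ler_expR lerN2 ler_wpM2r//.
by rewrite lef_pV2 ?posrE// ler_nat.
Qed.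

(** [c] is the sign of the phase: -1 serves the Fourier transform, 1 the propagator. Integrability
    of [g] is assumed so that the transform is a genuine integral at every point. *)
Lemma bessel_fourier n c (g : Rn R n -> R[i]) : c ^+ 2 = 1 ->
  (lebesgue_Rn n).-integrable setT (fun x => (complex.Re (g x))%:E) ->
  (lebesgue_Rn n).-integrable setT (fun x => (complex.Im (g x))%:E) ->
  (\int[lebesgue_Rn n]_xi
      (Normc.normc (Cintegral (fun x => expi (c * dotp xi x) * g x)) ^+ 2)%:E
   <= ((2 * pi) ^+ n)%:E * \int[lebesgue_Rn n]_x (Normc.normc (g x) ^+ 2)%:E)%E.
Proof.
move=> c1 iu iv.
pose u x := complex.Re (g x); pose v x := complex.Im (g x).
pose phi (z : Rn R n * Rn R n) : R := c * dotp z.2 z.1.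
pose C xi :=
  \int[lebesgue_Rn n]_x (u x * cos (phi (x, xi)) - v x * sin (phi (x, xi))).
pose S xi :=
  \int[lebesgue_Rn n]_x (u x * sin (phi (x, xi)) + v x * cos (phi (x, xi))).
have mphi : measurable_fun setT phi.
  apply: measurable_funM => //.
  exact: (measurable_dotp measurable_snd measurable_fst).
have [mu_ mv] : measurable_fun setT u /\ measurable_fun setT v.
  by split; apply/measurable_EFinP; [case/integrableP : iu|case/integrableP : iv].
have swapm : measurable_fun setT (fun z : Rn R n * Rn R n => phi (z.2, z.1)).
  apply: measurable_funM => //.
  exact: (measurable_dotp measurable_fst measurable_snd).
have mC : measurable_fun setT C.
  apply: (@measurable_Rintegral_param _ _ _ _ R (lebesgue_Rn n)
    (fun z : Rn R n * Rn R n =>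
    u z.2 * cos (phi (z.2, z.1)) - v z.2 * sin (phi (z.2, z.1)))).
  apply: measurable_funB; apply: measurable_funM.
  - exact: (measurableT_comp mu_ measurable_snd).
  - exact: measurable_cos.
  - exact: (measurableT_comp mv measurable_snd).
  - exact: measurable_sin.
have mS : measurable_fun setT S.
  apply: (@measurable_Rintegral_param _ _ _ _ R (lebesgue_Rn n)
    (fun z : Rn R n * Rn R n =>
    u z.2 * sin (phi (z.2, z.1)) + v z.2 * cos (phi (z.2, z.1)))).
  apply: measurable_funD; apply: measurable_funM.
  - exact: (measurableT_comp mu_ measurable_snd).
  - exact: measurable_sin.
  - exact: (measurableT_comp mv measurable_snd).
  - exact: measurable_cos.
rewrite (eq_integral (fun xi => (C xi ^+ 2 + S xi ^+ 2)%:E)); last first.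
  move=> xi _; rewrite sqr_normc; congr (_ ^+ 2 + _ ^+ 2)%:E;
    apply: eq_Rintegral => x _.
    by rewrite Re_expiM.
  by rewrite Im_expiM.
under [X in (_ * X)%E]eq_integral do rewrite sqr_normc.
pose I_ k xi : \bar R :=
  (weight_Rn (k.+1%:R^-1 : R) xi * (C xi ^+ 2 + S xi ^+ 2))%:E.
have CS0 xi : 0 <= C xi ^+ 2 + S xi ^+ 2 by rewrite addr_ge0// sqr_ge0.
have w0 e (xi : Rn R n) : 0 <= weight_Rn e xi.
  by apply: prodr_ge0 => i _; exact: laplace_weight_ge0.
have mI k : measurable_fun setT (I_ k).
  apply/measurable_EFinP; apply: measurable_funM; first exact: measurable_weight_Rn.
  by apply: measurable_funD; apply: measurable_funX.
have cvgI : (\int[lebesgue_Rn n]_xi I_ k xi)%E @[k --> \oo] -->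
    (\int[lebesgue_Rn n]_xi (C xi ^+ 2 + S xi ^+ 2)%:E)%E.
  rewrite (eq_integral (fun xi => limn (I_^~ xi))); last first.
    move=> xi _; apply/esym/cvg_lim => //.
    apply: cvg_EFin; first exact: nearW.
    rewrite -[X in _ --> X]mul1r; apply: cvgM; last exact: cvg_cst.
    exact: cvg_weight_Rn.
  apply: cvg_monotone_convergence => //.
  - by move=> k xi _; rewrite lee_fin mulr_ge0.
  - move=> xi _ a b ab; rewrite lee_fin ler_wpM2r//.
    exact: nd_weight_Rn.
(* It suffices to bound the weighted integral for each [k], since the mass (2 pi)^n of the kernel is
   the same for all of them. *)
rewrite -(cvg_lim _ cvgI)//; apply: lime_le.
  by apply/cvg_ex; eexists; exact: cvgI.
apply: nearW => k.
have e0 : 0 < k.+1%:R^-1 :> R by rewrite invr_gt0.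
set e := k.+1%:R^-1 in e0.
pose K (x y : Rn R n) : R :=
  \prod_(i < n) poisson_kernel e ((tnth x i : R) - tnth y i).
(* The Poisson kernel depends only on the square of its argument, so the sign [c] drops out. *)
have pkE (x y : Rn R n) :
    \prod_(i < n) poisson_kernel e (c * ((tnth x i : R) - tnth y i)) = K x y.
  by apply: eq_bigr => i _; rewrite /poisson_kernel exprMn c1 mul1r.
have phiE (x y xi : Rn R n) : phi (x, xi) - phi (y, xi) =
    linear_Rn (fun i => c * ((tnth x i : R) - tnth y i)) xi.
  rewrite /phi /= -mulrBr /dotp -sumrB mulr_sumr /linear_Rn.
  by apply: eq_bigr => i _; rewrite -mulrBr mulrCA.
apply: (@bessel_kernel _ _ _ _ R (lebesgue_Rn n) (lebesgue_Rn n) phi u v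
  (weight_Rn e) K ((2 * pi) ^+ n)) => //.
- exact: integrable_weight_Rn.
- by move=> x y; apply: prodr_ge0 => i _; rewrite poisson_kernel_ge0// ltW.
- apply: measurable_prod => i _.
  apply: (@measurableT_comp _ _ _ _ _ _ (poisson_kernel e)).
    by apply: continuous_measurable_fun; exact: continuous_poisson_kernel.
  apply: measurable_funB.
    exact: (measurableT_comp (measurable_tnth i) measurable_fst).
  exact: (measurableT_comp (measurable_tnth i) measurable_snd).
- move=> x y; rewrite -pkE; under eq_Rintegral do rewrite phiE.
  by case: (integral_weight_trig (fun i => c * ((tnth x i : R) - tnth y i)) e0).
- move=> x y; under eq_Rintegral do rewrite phiE.
  by case: (integral_weight_trig (fun i => c * ((tnth x i : R) - tnth y i)) e0).
- by rewrite exprn_ge0// mulr_ge0// pi_ge0.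
- by move=> x; rewrite (integral_poisson_Rn (tnth x) e0).
Qed.

End plancherel.

(** * Essential support *)

Section ess_support.
Context {R : realType}.

(** Boxes with rational corners are indexed by a countable type and stand in for balls as a
    countable base of open sets. *)
Definition rational_box n (q : n.-tuple (rat * rat)) : set (Rn R n) :=
  [set x | forall i,
    ratr (tnth q i).1 < (tnth x i : R) /\ (tnth x i : R) < ratr (tnth q i).2].

Lemma rational_box_edist n (x : Rn R n) (r : R) : 0 < r ->
  exists q, rational_box q x /\ (rational_box q `<=` [set y | Defs.edist x y < r]).
Proof.
(* Every point of the box is within d of [x] in each coordinate, and n d^2 < r^2 because n < (n +
   1)^2; taking n + 1 also covers n = 0. *)
move=> r0; pose d := r / n.+1%:R.
have d0 : 0 < d by rewrite divr_gt0.
have /choice[f fP] : forall i : 'I_n, exists q : rat * rat,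
    (tnth x i : R) - d < ratr q.1 < (tnth x i : R) /\
    (tnth x i : R) < ratr q.2 < (tnth x i : R) + d.
  move=> i; have h1 : (tnth x i : R) - d < tnth x i by rewrite ltrBlDr ltrDl.
  have h2 : (tnth x i : R) < (tnth x i : R) + d by rewrite ltrDl.
  have [p pP] := rat_in_itvoo h1; have [q qP] := rat_in_itvoo h2.
  by exists (p, q); move: pP qP; rewrite !in_itv.
exists [tuple f i | i < n]; split.
  by move=> i; rewrite tnth_mktuple; have [/andP[_ ->] /andP[-> _]] := fP i.
move=> y /= yP.
rewrite /Defs.edist -[ltRHS]gtr0_norm// -sqrtr_sqr ltr_sqrt ?exprn_gt0//.
apply: (@le_lt_trans _ _ (\sum_(i < n) d ^+ 2)).
  apply: ler_sum => i _; move: (yP i); rewrite tnth_mktuple => -[y1 y2].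
  have [/andP[p1 p2] /andP[q1 q2]] := fP i.
  rewrite -real_normK ?num_real// expr2 expr2 ler_pM//.
    by rewrite ler_norml; apply/andP; split; lra.
  by rewrite ler_norml; apply/andP; split; lra.
rewrite sumr_const card_ord -mulr_natr /d expr_div_n -mulrA [_^-1 * _]mulrC.
rewrite gtr_pMr ?exprn_gt0// ltr_pdivrMr ?exprn_gt0// mul1r -natrX ltr_nat.
by rewrite (leq_trans (ltnSn n))// -mulnn leq_pmulr.
Qed.

(** A Lindelof argument: a point outside the support has a ball on which [g] vanishes almost
    everywhere, that ball contains a rational box around the point, and there are countably many
    such boxes. *)
Lemma ess_support_ae n (g : Rn R n -> R[i]) (B : set (Rn R n)) :
  ess_support g `<=` B ->
  {ae lebesgue_Rn n, forall xi, ~ B xi -> g xi = 0}.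
Proof.
move=> gB.
pose good (q : n.-tuple (rat * rat)) :=
  {ae lebesgue_Rn n, forall x, rational_box q x -> g x = 0}.
(* [F k] is the exceptional set in the box coded by [k]; it is empty when [k] codes no box or one
   that is not [good], so every [F k] is negligible. *)
pose F k : set (Rn R n) := [set x | exists q : n.-tuple (rat * rat),
  [/\ unpickle k = Some q, good q, rational_box q x & g x <> 0]].
have nF k : (lebesgue_Rn n).-negligible (F k).
  case E : (@unpickle (n.-tuple (rat * rat)) k) => [q|]; last first.
    apply: (@negligibleS _ _ _ _ set0); last exact: negligible_set0.
    by move=> x [q [/=]]; rewrite E.
  have [gq|ngq] := pselect (good q); last first.
    apply: (@negligibleS _ _ _ _ set0); last exact: negligible_set0.
    by move=> x [q' [/=]]; rewrite E => -[<-].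
  apply: negligibleS gq => x [q' [/=]]; rewrite E => -[<-] _ qx gx0 h.
  exact/gx0/h.
apply: negligibleS (negligible_bigcup nF) => x /= /not_implyP[nBx gx0].
have : ~ ess_support g x by move=> /gB.
move=> /existsNP[r /not_implyP[r0 /contrapT h]].
have [q [qx qr]] := rational_box_edist x r0.
exists (pickle q) => //; exists q; split => //; first exact: pickleK.
by apply: filterS h => y h /qr; exact: h.
Qed.

End ess_support.

(** * Variation of oscillatory integrals *)

Lemma is_derive_sqrD (R : realType) (f g : R -> R) (x f' g' : R) :
  is_derive x (1 : R) f f' -> is_derive x (1 : R) g g' ->
  is_derive x (1 : R) (fun y => f y ^+ 2 + g y ^+ 2) (2 * (f x * f' + g x * g')).
Proof.
by move=> df dg; apply: is_derive_eq; rewrite /GRing.scale /=; ring.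
Qed.

Section variation.
Context {R : realType}.
Let leb := @lebesgue_measure R.

(** The fundamental theorem of calculus between [s] and [t], whose segment lies in the interval [J].
    Enlarging the segment to all of [J] makes the right side independent of [t], hence a bound for a
    supremum. *)
Lemma variation_le_integral (D D' G : R -> R) (J : set R) (s t : R) :
  (forall x : R, is_derive x (1 : R) D (D' x)) -> continuous D' -> continuous G ->
  (forall x, `|D' x| <= G x) -> is_interval J -> measurable J -> J s -> J t ->
  ((D t)%:E <= (D s)%:E + \int[leb]_(x in J) (G x)%:E)%E.
Proof.
move=> dD cD' cG DG iJ mJ.
have G0 x : 0 <= G x by exact: le_trans (DG x).
have mG : measurable_fun setT G by exact: continuous_measurable_fun.
have mD' : measurable_fun setT D' by exact: continuous_measurable_fun.
have cD x : {for x, continuous D}.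
  by apply/differentiable_continuous/derivable1_diffP; case: (dD x).
have FTC a b : J a -> J b -> a < b ->
    (`|D b - D a|%R%:E <= \int[leb]_(x in J) (G x)%:E)%E.
  move=> Ja Jb ab.
  rewrite -abse_EFin EFinB -(@continuous_FTC2 R D' D a b ab); last 3 first.
  - exact: continuous_subspaceT.
  - split.
    + by move=> x _; case: (dD x).
    + by apply: cvg_at_right_filter; exact: cD.
    + by apply: cvg_at_left_filter; exact: cD.
  - by move=> x _; rewrite derive1E; case: (dD x).
  have mab : measurable `[a, b] by [].
  apply: (@le_trans _ _ (\int[leb]_(x in `[a, b]) `|(D' x)%:E|)%E).
    by apply: le_abse_integral => //; apply/measurable_EFinP/measurable_funTS.
  apply: (@le_trans _ _ (\int[leb]_(x in `[a, b]) (G x)%:E)%E).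
    apply: ge0_le_integral => //.
    - apply: measurableT_comp => //; apply/measurable_EFinP; exact: measurable_funTS.
    - apply/measurable_EFinP; exact: measurable_funTS.
    - by move=> x _; rewrite lee_fin.
  apply: ge0_subset_integral => //.
  - apply/measurable_EFinP; exact: measurable_funTS.
  - by move=> x _; rewrite lee_fin.
  - move=> x /=; rewrite in_itv/= => /andP[ax xb]; apply: (iJ a b) => //.
    by rewrite ax.
move=> Js Jt; rewrite -leeBlDl//.
have [st|ts|->] := ltgtP s t.
- by apply: le_trans (FTC _ _ Js Jt st); rewrite -EFinB lee_fin ler_norm.
- by apply: le_trans (FTC _ _ Jt Js ts); rewrite -EFinB lee_fin distrC ler_norm.
- by rewrite subee// integral_ge0// => x _; rewrite lee_fin.
Qed.

End variation.

Section oscillatory.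
Context d (Y : measurableType d) (R : realType).
Variable nu : {measure set Y -> \bar R}.
Variables (rho : Y -> R) (L : R).
Hypotheses (mrho : measurable_fun setT rho) (rhoL : forall y, `|rho y| <= L).

(** The real part of the integral of (p - i q) exp(i t rho). Real and imaginary parts of an
    oscillatory integral and all their derivatives in t have this shape, so one differentiation
    lemma serves for all. *)
Definition oscillatory (p q : Y -> R) (t : R) : R :=
  \int[nu]_y (p y * cos (t * rho y) + q y * sin (t * rho y)).

Let integrable_rhoM p : nu.-integrable setT (EFin \o p) ->
  nu.-integrable setT (EFin \o (fun y => rho y * p y)).
Proof.
move=> ip; have mp : measurable_fun setT p.
  by apply/measurable_EFinP; case/integrableP : ip.
have iLp := integrableZl measurableT L (integrable_norm ip).
apply: (integrable_le _ iLp); first exact: measurable_funM.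
by move=> y /=; rewrite normrM ler_wpM2r.
Qed.

Let integrable_oscillatory p q t : nu.-integrable setT (EFin \o p) ->
  nu.-integrable setT (EFin \o q) -> nu.-integrable setT
    (EFin \o (fun y => p y * cos (t * rho y) + q y * sin (t * rho y))).
Proof.
move=> ip iq.
have mp : measurable_fun setT p by apply/measurable_EFinP; case/integrableP : ip.
have mq : measurable_fun setT q by apply/measurable_EFinP; case/integrableP : iq.
have ipq := integrableD measurableT (integrable_norm ip) (integrable_norm iq).
apply: (integrable_le _ ipq) => [|y /=].
  apply: measurable_funD; apply: measurable_funM => //.
    by apply: measurable_cos; exact: measurable_funM.
  by apply: measurable_sin; exact: measurable_funM.
rewrite (le_trans (ler_normD _ _))// !normrM lerD// ler_piMr//.
  by rewrite ler_norml cos_geN1 cos_le1.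
by rewrite ler_norml sin_geN1 sin_le1.
Qed.

(** Because |rho| <= L, the t-derivative of the integrand is dominated by L (|p| + |q|) at all
    times, so differentiation under the integral applies on any window around [t]. *)
Lemma is_derive_oscillatory p q (t : R) : nu.-integrable setT (EFin \o p) ->
  nu.-integrable setT (EFin \o q) ->
  is_derive t (1 : R) (oscillatory p q)
    (oscillatory (fun y => rho y * q y) (fun y => - (rho y * p y)) t).
Proof.
move=> ip iq.
pose f (t : R) y := p y * cos (t * rho y) + q y * sin (t * rho y).
pose f' (t : R) y :=
  rho y * q y * cos (t * rho y) + - (rho y * p y) * sin (t * rho y).
have df (x : R) y : is_derive x (1 : R) (f ^~ y) (f' x y).
  rewrite /f /f'; apply: is_derive_eq; rewrite /GRing.scale /=; ring.
have d1f (x : R) y : partial1of2 f x y = f' x y.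
  by rewrite partial1of2E; case: (df x y).
pose G y := L * (`|p y| + `|q y|).
have L0 (y : Y) : 0 <= L by rewrite (le_trans _ (rhoL y)).
have G0 y : 0 <= G y by rewrite mulr_ge0 ?(L0 y)// addr_ge0.
have iG : nu.-integrable setT (EFin \o G).
  exact: (integrableZl measurableT L
    (integrableD measurableT (integrable_norm ip) (integrable_norm iq))).
have It : t \in `]t - 1, t + 1[ by rewrite in_itv/= ltrBlDr !ltrDl ltr01.
have intf x : (`]t - 1, t + 1[%classic : set R) x ->
    nu.-integrable setT (EFin \o f x).
  by move=> _; exact: integrable_oscillatory.
have derf x y : (`]t - 1, t + 1[%classic : set R) x -> setT y ->
    derivable (f ^~ y) x 1.
  by move=> _ _; case: (df x y).
have bnd (r w : R) y : `|w| <= 1 -> `|rho y * r * w| <= L * `|r|.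
  by move=> w1; rewrite normrM -[leRHS]mulr1 ler_pM// normrM ler_wpM2r.
have Gub x y : (`]t - 1, t + 1[%classic : set R) x -> setT y ->
    `|partial1of2 f x y| <= G y.
  move=> _ _; rewrite d1f /G mulrDr addrC (le_trans (ler_normD _ _))//.
  by rewrite mulNr normrN lerD// bnd// ler_norml
    ?sin_geN1 ?sin_le1 ?cos_geN1 ?cos_le1.
apply: DeriveDef.
  exact: (derivable_under_integral measurableT It intf derf G0 iG Gub).
rewrite -derive1E.
rewrite [LHS](differentiation_under_integral measurableT It intf derf G0 iG Gub).
by apply: eq_Rintegral => y _; rewrite d1f.
Qed.

Lemma continuous_oscillatory p q : nu.-integrable setT (EFin \o p) ->
  nu.-integrable setT (EFin \o q) -> continuous (oscillatory p q).
Proof.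
move=> ip iq t; apply/differentiable_continuous/derivable1_diffP.
by case: (is_derive_oscillatory t ip iq).
Qed.

(* With F(t) = \int (p + i q) e^(i t rho), this is
   |F(t)|^2 <= |F(s)|^2 + \int_J (L |F|^2 + |F'|^2 / L). *)
Lemma sqr_oscillatory_le p q (J : set R) (s t : R) :
  nu.-integrable setT (EFin \o p) -> nu.-integrable setT (EFin \o q) ->
  0 < L -> is_interval J -> measurable J -> J s -> J t ->
  (((oscillatory p (fun y => - q y) t) ^+ 2 + (oscillatory q p t) ^+ 2)%:E <=
   ((oscillatory p (fun y => - q y) s) ^+ 2 + (oscillatory q p s) ^+ 2)%:E +
    \int[@lebesgue_measure R]_(x in J)
      (L * ((oscillatory p (fun y => - q y) x) ^+ 2 + (oscillatory q p x) ^+ 2) +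
       L^-1 *
        ((oscillatory (fun y => - (rho y * q y)) (fun y => - (rho y * p y)) x) ^+ 2
       + (oscillatory (fun y => rho y * p y) (fun y => - (rho y * q y)) x) ^+ 2))%:E)%E.
Proof.
move=> ip iq L0 iJ mJ Js Jt.
set re := oscillatory p _; set im := oscillatory q p.
set re' := oscillatory (fun y => - (rho y * q y)) _.
set im' := oscillatory (fun y => rho y * p y) _.
have iN g : nu.-integrable setT (EFin \o g) ->
  nu.-integrable setT (EFin \o (fun y => - g y)).
  by move=> ig; exact: (integrableN ig).
have iqN := iN _ iq; have irp := integrable_rhoM ip; have irq := integrable_rhoM iq.
have irpN := iN _ irp; have irqN := iN _ irq.
have dre (x : R) : is_derive x (1 : R) re (re' x).
  have := is_derive_oscillatory x ip iqN.
  by under [X in oscillatory X _ x]eq_fun do rewrite mulrN.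
have dim (x : R) : is_derive x (1 : R) im (im' x).
  exact: is_derive_oscillatory x iq ip.
have cre : continuous re by exact: continuous_oscillatory.
have cim : continuous im by exact: continuous_oscillatory.
have cre' : continuous re' by exact: continuous_oscillatory.
have cim' : continuous im' by exact: continuous_oscillatory.
have csqr (f : R -> R) : continuous f -> continuous (fun x => f x ^+ 2).
  by move=> cf x; apply: (@continuous_comp _ _ _ f (fun y => y ^+ 2));
    [exact: cf|exact: exprn_continuous].
have dD (x : R) : is_derive x (1 : R) (fun x => re x ^+ 2 + im x ^+ 2)
    (2 * (re x * re' x + im x * im' x)).
  exact: (is_derive_sqrD (dre x) (dim x)).
have cD : continuous (fun x => 2 * (re x * re' x + im x * im' x)).
  by move=> x; apply: cvgM; [exact: cvg_cst|apply: cvgD; apply: cvgM;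
    [exact: cre|exact: cre'|exact: cim|exact: cim']].
have cG : continuous (fun x => L * (re x ^+ 2 + im x ^+ 2) +
    L^-1 * (re' x ^+ 2 + im' x ^+ 2)).
  by move=> x; apply: cvgD; (apply: cvgM; first exact: cvg_cst);
    apply: cvgD; apply: csqr.
have L_neq0 : L != 0 by rewrite gt_eqF.
(* Both L (a - b / L)^2 and L (a + b / L)^2 are nonnegative; applied to real and imaginary parts
   separately, this avoids Cauchy-Schwarz for the pair. *)
have amgm (a b : R) : `|2 * (a * b)| <= L * a ^+ 2 + L^-1 * b ^+ 2.
  have h1 : 0 <= L * (a - L^-1 * b) ^+ 2 by rewrite mulr_ge0 ?sqr_ge0 ?ltW.
  have h2 : 0 <= L * (a + L^-1 * b) ^+ 2 by rewrite mulr_ge0 ?sqr_ge0 ?ltW.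
  have e1 : L * (a - L^-1 * b) ^+ 2 = L * a ^+ 2 + L^-1 * b ^+ 2 - 2 * (a * b).
    by field.
  have e2 : L * (a + L^-1 * b) ^+ 2 = L * a ^+ 2 + L^-1 * b ^+ 2 + 2 * (a * b).
    by field.
  by rewrite ler_norml; apply/andP; split; lra.
have DG (x : R) : `|2 * (re x * re' x + im x * im' x)| <=
    L * (re x ^+ 2 + im x ^+ 2) + L^-1 * (re' x ^+ 2 + im' x ^+ 2).
  rewrite mulrDr (le_trans (ler_normD _ _))//.
  have := amgm (re x) (re' x); have := amgm (im x) (im' x).
  by rewrite !mulrDr; lra.
exact: (variation_le_integral dD cD cG DG iJ mJ Js Jt).
Qed.

End oscillatory.

(** * L^2 norms of Fourier transforms *)

Section L2_Rn.
Context {R : realType} (n : nat).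
Implicit Types f g h : Rn R n -> R[i].
Let mu := @lebesgue_Rn R n.

Definition measurable_complex d (T : measurableType d) (f : T -> R[i]) :=
  measurable_fun setT (fun x => complex.Re (f x)) /\
  measurable_fun setT (fun x => complex.Im (f x)).

Lemma measurable_normc d (T : measurableType d) (f : T -> R[i]) :
  measurable_complex f -> measurable_fun setT (fun x => Normc.normc (f x)).
Proof.
move=> [mr mi].
rewrite (_ : (fun x => _) = (fun x =>
  Num.sqrt (complex.Re (f x) ^+ 2 + complex.Im (f x) ^+ 2))); last first.
  by apply/funext => x; case: (f x).
apply: (@measurableT_comp _ _ _ _ _ _ (@Num.sqrt R)).
  by apply: continuous_measurable_fun; exact: sqrt_continuous.
by apply: measurable_funD; apply: measurable_funX.
Qed.

Lemma measurable_complexD d (T : measurableType d) (f g : T -> R[i]) :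
  measurable_complex f -> measurable_complex g ->
  measurable_complex (fun x => f x + g x).
Proof.
move=> [fr fi] [gr gi]; split.
  rewrite (_ : (fun x => _) = (fun x => complex.Re (f x) + complex.Re (g x))).
    exact: measurable_funD.
  by apply/funext => x; case: (f x) (g x) => ? ? [].
rewrite (_ : (fun x => _) = (fun x => complex.Im (f x) + complex.Im (g x))).
  exact: measurable_funD.
by apply/funext => x; case: (f x) (g x) => ? ? [].
Qed.

Lemma measurable_complexN d (T : measurableType d) (f : T -> R[i]) :
  measurable_complex f -> measurable_complex (fun x => - f x).
Proof.
move=> [fr fi]; split.
  rewrite (_ : (fun x => _) = (fun x => - complex.Re (f x))).
    exact: measurable_funN.
  by apply/funext => x; case: (f x).
rewrite (_ : (fun x => _) = (fun x => - complex.Im (f x))).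
  exact: measurable_funN.
by apply/funext => x; case: (f x).
Qed.

Lemma normc_ge0 (z : R[i]) : 0 <= Normc.normc z.
Proof. by case: z => a b; exact: sqrtr_ge0. Qed.

Lemma normc_ReIm (z : R[i]) :
  `|complex.Re z| <= Normc.normc z /\ `|complex.Im z| <= Normc.normc z.
Proof.
case: z => a b /=; rewrite -!sqrtr_sqr; split; apply: ler_wsqrtr.
  by rewrite lerDl sqr_ge0.
by rewrite lerDr sqr_ge0.
Qed.

Lemma LpnormC2E f : LpnormC 2%:E f =
  ((\int[mu]_x (Normc.normc (f x) ^+ 2)%:E) `^ 2^-1)%E.
Proof.
rewrite /LpnormC unlock; congr (_ `^ _)%E; apply: eq_integral => x _.
by rewrite abse_EFin poweR_EFin powR_mulrn// ger0_norm// normc_ge0.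
Qed.

Let I f : \bar R := (\int[mu]_x (Normc.normc (f x) ^+ 2)%:E)%E.

Let I_ge0 f : (0 <= I f)%E.
Proof. by apply: integral_ge0 => x _; rewrite lee_fin sqr_ge0. Qed.

Lemma le_poweR_half (x y : \bar R) (k : R) : (0 <= x)%E -> (0 <= y)%E -> 0 <= k ->
  (x <= (k ^+ 2)%:E * y)%E -> (x `^ 2^-1 <= k%:E * y `^ 2^-1)%E.
Proof.
move=> x0 y0 k0 xy.
have -> : (k%:E = (k ^+ 2)%:E `^ 2^-1)%E.
  by rewrite poweR_EFin powR12_sqrt ?sqr_ge0// sqrtr_sqr ger0_norm.
have k20 : (0 <= (k ^+ 2)%:E)%E by rewrite lee_fin sqr_ge0.
rewrite -poweRM//; apply: gt0_ler_poweR => //.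
  by rewrite in_itv/= leey andbT.
by rewrite in_itv/= leey andbT mule_ge0.
Qed.

(** Minkowski is applied to the real functions |f| and |g|; the pointwise inequality |f + g| <= |f|
    + |g| does the rest. *)
Lemma LpnormC2_triangle f g : measurable_complex f -> measurable_complex g ->
  (LpnormC 2%:E (fun x => (f x + g x)%R) <= LpnormC 2%:E f + LpnormC 2%:E g)%E.
Proof.
move=> mf mg.
have one2 : (1 <= 2%:E :> \bar R)%E by rewrite lee_fin ler1n.
apply: le_trans (eminkowski mu (measurable_normc mf) (measurable_normc mg) one2).
rewrite LpnormC2E unlock; apply: gt0_ler_poweR => //.
- by rewrite in_itv/= leey I_ge0.
- by rewrite in_itv/= leey integral_ge0// => x _; exact: poweR_ge0.
apply: le_integral_nonneg => x; first by rewrite lee_fin sqr_ge0.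
rewrite /= powR_mulrn// lee_fin.
rewrite [X in _ <= X ^+ 2]ger0_norm ?addr_ge0 ?normc_ge0//.
rewrite lerXn2r ?nnegrE ?addr_ge0 ?normc_ge0//.
exact: le_normcD.
Qed.

Lemma LpnormC2_opp f g :
  LpnormC 2%:E (fun x => f x - g x) = LpnormC 2%:E (fun x => g x - f x).
Proof.
by apply: eq_Lnorm => x; rewrite -opprB normcN.
Qed.

Lemma LpC1_integrable f : LpC 1%:E f ->
  mu.-integrable setT (fun x => (complex.Re (f x))%:E) /\
  mu.-integrable setT (fun x => (complex.Im (f x))%:E).
Proof.
move=> [mr mi]; rewrite /LpnormC Lnorm1 => fin.
have iN : mu.-integrable setT (EFin \o (fun x => Normc.normc (f x))).
  apply/integrableP; split => //.
  by apply/measurable_EFinP; exact: measurable_normc.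
by split; apply: (integrable_le _ iN) => // x; case: (normc_ReIm (f x)).
Qed.

Lemma measurable_fourier_integral f : measurable_complex f ->
  measurable_complex (fourier_integral f).
Proof.
move=> [mr mi].
have mph : measurable_fun setT (fun z : Rn R n * Rn R n => - dotp z.1 z.2).
  by apply: measurable_funN; exact: (measurable_dotp measurable_fst measurable_snd).
have mr2 : measurable_fun setT (fun z : Rn R n * Rn R n => complex.Re (f z.2)).
  exact: (measurableT_comp mr measurable_snd).
have mi2 : measurable_fun setT (fun z : Rn R n * Rn R n => complex.Im (f z.2)).
  exact: (measurableT_comp mi measurable_snd).
have ms := measurable_sin mph; have mc := measurable_cos mph.
split.
  apply: (@measurable_Rintegral_param _ _ _ _ R (lebesgue_Rn n)
    (fun z : Rn R n * Rn R n =>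
    complex.Re (expi (- dotp z.1 z.2) * f z.2))).
  under eq_fun do rewrite Re_expiM.
  by apply: measurable_funB; apply: measurable_funM.
apply: (@measurable_Rintegral_param _ _ _ _ R (lebesgue_Rn n)
    (fun z : Rn R n * Rn R n =>
  complex.Im (expi (- dotp z.1 z.2) * f z.2))).
under eq_fun do rewrite Im_expiM.
by apply: measurable_funD; apply: measurable_funM.
Qed.

Let S := Num.sqrt ((2 * pi : R) ^+ n).

Let S_ge0 : 0 <= S. Proof. exact: sqrtr_ge0. Qed.

Let S_sqr : S ^+ 2 = (2 * pi) ^+ n.
Proof. by rewrite sqr_sqrtr// exprn_ge0// mulr_ge0// pi_ge0. Qed.

Lemma fourier_integral_L2 f : LpC 1%:E f ->
  (LpnormC 2%:E (fourier_integral f) <= S%:E * LpnormC 2%:E f)%E.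
Proof.
move=> /LpC1_integrable[ir ii]; rewrite !LpnormC2E; apply: le_poweR_half;
  [exact: I_ge0|exact: I_ge0|exact: S_ge0|].
rewrite S_sqr.
have c1 : (- 1 : R) ^+ 2 = 1 by rewrite sqrrN expr1n.
apply: le_trans (bessel_fourier c1 ir ii); apply: le_integral_nonneg => x.
  by rewrite lee_fin sqr_ge0.
suff -> : fourier_integral f x = Cintegral (fun y => expi (- 1 * dotp x y) * f y).
  by [].
by congr Cintegral; apply/funext => y; rewrite mulN1r.
Qed.

(** The bound known on integrable functions passes to the limit: the norm of [g] is at most that of
    g - F_k^ plus S times the norms of F_k - f and f, and both error terms tend to 0. *)
Lemma fourier_L2 f g : is_fourier f g ->
  (LpnormC 2%:E g <= S%:E * LpnormC 2%:E f)%E.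
Proof.
move=> [[fr fi flty] [gr gi _] [F [LF Ff Fg]]].
have mF k : measurable_complex (F k) by case: (LF k) => -[].
pose u k := (LpnormC 2%:E (fun xi => (fourier_integral (F k) xi - g xi)%R) +
  S%:E * (LpnormC 2%:E (fun x => (F k x - f x)%R) + LpnormC 2%:E f))%E.
have ge0 h : (0 <= LpnormC 2%:E h)%E by exact: Lnorm_ge0.
have ffin : LpnormC 2%:E f \is a fin_num by rewrite ge0_fin_numE.
have cu : u k @[k --> \oo] --> (S%:E * LpnormC 2%:E f)%E.
  rewrite -[X in _ --> X]add0e; apply: cvgeD => //.
  apply: cvgeZl => //; rewrite -[X in _ --> X]add0e.
  by apply: cvgeD => //; exact: cvg_cst.
rewrite -(cvg_lim _ cu)//; apply: lime_ge.
  by apply/cvg_ex; eexists; exact: cu.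
apply: nearW => k.
have mFk := measurable_fourier_integral (mF k).
apply: (@le_trans _ _
    (LpnormC 2%:E (fun xi => (g xi - fourier_integral (F k) xi)%R) +
    LpnormC 2%:E (fourier_integral (F k)))%E).
  apply: le_trans (LpnormC2_triangle _ mFk).
    rewrite le_eqVlt; apply/orP; left; apply/eqP; apply: eq_Lnorm => x.
    by rewrite subrK.
  by apply: measurable_complexD => //; exact: measurable_complexN.
rewrite LpnormC2_opp leeD2l//.
apply: le_trans (fourier_integral_L2 _) _; first by case: (LF k).
rewrite lee_wpmul2l// ?lee_fin//.
apply: le_trans (LpnormC2_triangle _ _); last by [].
  rewrite le_eqVlt; apply/orP; left; apply/eqP; apply: eq_Lnorm => x.
  by rewrite subrK.
by apply: measurable_complexD => //; exact: measurable_complexN.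
Qed.

End L2_Rn.

(** * The maximal function of a truncated wave *)

Section wave.
Context {R : realType} (n : nat).
Let mu := @lebesgue_Rn R n.
Let leb := @lebesgue_measure R.
Variables (rho : Rn R n -> R) (L : R) (h : Rn R n -> R[i]).
Hypotheses (mrho : measurable_fun setT rho) (rhoL : forall xi, `|rho xi| <= L)
  (L_gt0 : 0 < L)
  (ihr : mu.-integrable setT (fun xi => (complex.Re (h xi))%:E))
  (ihi : mu.-integrable setT (fun xi => (complex.Im (h xi))%:E)).

Definition wave (t : R) (x : Rn R n) : R[i] :=
  Cintegral (fun xi => expi (dotp xi x) * (expi (t * rho xi) * h xi)).

(** The time derivative is given directly as an integral with amplitude i rho h, so that the Bessel
    inequality applies to it as it does to [wave]. *)
Definition wave_deriv (t : R) (x : Rn R n) : R[i] :=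
  Cintegral (fun xi => expi (dotp xi x) *
    (expi (t * rho xi) * ((0 +i* rho xi)%C * h xi))).

(** At fixed [x] the spatial phase is absorbed into the amplitude p + i q, which leaves an
    oscillatory integral in t alone. *)
Let p x xi : R := complex.Re (expi (dotp xi x) * h xi).
Let q x xi : R := complex.Im (expi (dotp xi x) * h xi).

Lemma normc_expiM theta (z : R[i]) : Normc.normc (expi theta * z) = Normc.normc z.
Proof.
by rewrite Normc.normcM /expi /= cos2Dsin2 sqrtr1 mul1r.
Qed.

Let mh : measurable_complex h.
Proof.
by split; apply/measurable_EFinP; [case/integrableP : ihr|case/integrableP : ihi].
Qed.

Lemma measurable_expiM d (T : measurableType d) (theta : T -> R) (f : T -> R[i]) :
  measurable_fun setT theta -> measurable_complex f ->
  measurable_complex (fun x => expi (theta x) * f x).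
Proof.
move=> mt [fr fi]; have ms := measurable_sin mt; have mc := measurable_cos mt.
split.
  under eq_fun do rewrite Re_expiM.
  by apply: measurable_funB; apply: measurable_funM.
under eq_fun do rewrite Im_expiM.
by apply: measurable_funD; apply: measurable_funM.
Qed.

Lemma integrable_complex_le (f g : Rn R n -> R[i]) :
  measurable_complex f -> (forall x, Normc.normc (f x) <= Normc.normc (g x)) ->
  mu.-integrable setT (fun x => (complex.Re (g x))%:E) ->
  mu.-integrable setT (fun x => (complex.Im (g x))%:E) ->
  mu.-integrable setT (fun x => (complex.Re (f x))%:E) /\
  mu.-integrable setT (fun x => (complex.Im (f x))%:E).
Proof.
move=> [mr mi] fg ir ii.
have iN := integrableD measurableT (integrable_norm ir) (integrable_norm ii).
have gle x : Normc.normc (g x) <= `|complex.Re (g x)| + `|complex.Im (g x)|.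
  rewrite -[leRHS]ger0_norm ?addr_ge0// -sqrtr_sqr.
  have -> : Normc.normc (g x) =
      Num.sqrt (complex.Re (g x) ^+ 2 + complex.Im (g x) ^+ 2).
    by case: (g x).
  apply: ler_wsqrtr; rewrite sqrrD !real_normK ?num_real//.
  by rewrite lerD2r lerDl mulrn_wge0// mulr_ge0.
split; apply: (integrable_le _ iN) => // x /=; apply: le_trans (gle x);
  apply: le_trans (fg x); by case: (normc_ReIm (f x)).
Qed.

Let integrable_phase (theta : Rn R n -> R) (f : Rn R n -> R[i]) :
  measurable_fun setT theta ->
  mu.-integrable setT (fun x => (complex.Re (f x))%:E) ->
  mu.-integrable setT (fun x => (complex.Im (f x))%:E) ->
  mu.-integrable setT (fun x => (complex.Re (expi (theta x) * f x))%:E) /\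
  mu.-integrable setT (fun x => (complex.Im (expi (theta x) * f x))%:E).
Proof.
move=> mt ir ii; apply: (integrable_complex_le _ _ ir ii).
  apply: measurable_expiM => //; split; apply/measurable_EFinP.
    by case/integrableP : ir.
  by case/integrableP : ii.
by move=> x; rewrite normc_expiM.
Qed.

Let mdotp x : measurable_fun setT (fun xi : Rn R n => dotp xi x).
Proof. by apply: (@measurable_dotp R n _ (Rn R n) id (fun=> x)). Qed.

Let ip x : mu.-integrable setT (EFin \o p x).
Proof. by case: (integrable_phase (mdotp x) ihr ihi). Qed.

Let iq x : mu.-integrable setT (EFin \o q x).
Proof. by case: (integrable_phase (mdotp x) ihr ihi). Qed.

Let waveE t x : wave t x = (oscillatory mu rho (p x) (fun y => - q x y) t +i*
  oscillatory mu rho (q x) (p x) t)%C.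
Proof.
rewrite /wave /Cintegral /oscillatory; congr (_ +i* _)%C;
  apply: eq_Rintegral => xi _; rewrite mulrCA.
  by rewrite Re_expiM mulNr.
by rewrite Im_expiM addrC.
Qed.

Let ReM_i (r : R) (z : R[i]) : complex.Re ((0 +i* r)%C * z) = - (r * complex.Im z).
Proof. by case: z => u v /=; ring. Qed.

Let ImM_i (r : R) (z : R[i]) : complex.Im ((0 +i* r)%C * z) = r * complex.Re z.
Proof. by case: z => u v /=; ring. Qed.

Let wave_derivE t x : wave_deriv t x =
  (oscillatory mu rho (fun y => - (rho y * q x y)) (fun y => - (rho y * p x y)) t +i*
   oscillatory mu rho (fun y => rho y * p x y) (fun y => - (rho y * q x y)) t)%C.
Proof.
rewrite /wave_deriv /Cintegral /oscillatory; congr (_ +i* _)%C;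
  apply: eq_Rintegral => xi _; rewrite mulrCA [in LHS](mulrCA (expi _) (0 +i* _)%C).
  by rewrite Re_expiM ReM_i ImM_i !mulNr.
by rewrite Im_expiM ReM_i ImM_i addrC.
Qed.

Lemma wave_sqr_le (J : set R) (s t : R) x : is_interval J -> measurable J ->
  J s -> J t ->
  ((Normc.normc (wave t x) ^+ 2)%:E <= (Normc.normc (wave s x) ^+ 2)%:E +
    \int[leb]_(r in J) (L * Normc.normc (wave r x) ^+ 2 +
      L^-1 * Normc.normc (wave_deriv r x) ^+ 2)%:E)%E.
Proof.
move=> iJ mJ Js Jt; rewrite !sqr_normc !waveE.
have := sqr_oscillatory_le mrho rhoL (ip x) (iq x) L_gt0 iJ mJ Js Jt.
congr (_ <= _ + _)%E; apply: eq_integral => r _.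
by rewrite !sqr_normc waveE wave_derivE.
Qed.

Let sndfst d1 d2 d3 (T1 : measurableType d1) (T2 : measurableType d2)
    (T3 : measurableType d3) :
  measurable_fun setT (fun z : (T1 * T2) * T3 => z.1.2).
Proof. exact: (measurableT_comp measurable_snd measurable_fst). Qed.

Let fstfst d1 d2 d3 (T1 : measurableType d1) (T2 : measurableType d2)
    (T3 : measurableType d3) :
  measurable_fun setT (fun z : (T1 * T2) * T3 => z.1.1).
Proof. exact: (measurableT_comp measurable_fst measurable_fst). Qed.

(** Joint measurability in position and time is needed to exchange the two integrations; a general
    amplitude [g] covers both [wave] and [wave_deriv]. *)
Let measurable_wave_gen (g : Rn R n -> R[i]) : measurable_complex g ->
  measurable_complex (fun z : Rn R n * measurableTypeR R =>
    Cintegral (fun xi => expi (dotp xi z.1) * (expi ((z.2 : R) * rho xi) * g xi))).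
Proof.
move=> [gr gi].
pose F (z : (Rn R n * measurableTypeR R) * Rn R n) : R[i] :=
  expi (dotp z.2 z.1.1) * (expi ((z.1.2 : R) * rho z.2) * g z.2).
have [mr mi] : measurable_complex F.
  apply: measurable_expiM.
    exact: (measurable_dotp measurable_snd (@fstfst _ _ _ _ _ _)).
  apply: measurable_expiM.
    apply: measurable_funM; first exact: sndfst.
    exact: (measurableT_comp mrho measurable_snd).
  by split; [exact: (measurableT_comp gr measurable_snd)
            |exact: (measurableT_comp gi measurable_snd)].
by split; [exact: (measurable_Rintegral_param (lebesgue_Rn n) mr)
          |exact: (measurable_Rintegral_param (lebesgue_Rn n) mi)].
Qed.

Let mrhoh : measurable_complex (fun xi => (0 +i* rho xi)%C * h xi).
Proof.
case: mh => hr hi; split.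
  under eq_fun do rewrite ReM_i.
  by apply: measurable_funN; exact: measurable_funM.
by under eq_fun do rewrite ImM_i; exact: measurable_funM.
Qed.

Let I (g : Rn R n -> R[i]) : \bar R := (\int[mu]_x (Normc.normc (g x) ^+ 2)%:E)%E.

Let normc_rhoh xi : Normc.normc ((0 +i* rho xi)%C * h xi) <= L * Normc.normc (h xi).
Proof.
rewrite Normc.normcM ler_wpM2r ?normc_ge0//=.
by rewrite expr0n/= add0r sqrtr_sqr.
Qed.

Let irhoh :
  mu.-integrable setT (fun xi => (complex.Re ((0 +i* rho xi)%C * h xi))%:E) /\
  mu.-integrable setT (fun xi => (complex.Im ((0 +i* rho xi)%C * h xi))%:E).
Proof.
have iLr := integrableZl measurableT L ihr.
have iLi := integrableZl measurableT L ihi.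
apply: (@integrable_complex_le _ (fun xi => (L%:C * h xi)%C)) => //.
- move=> xi; rewrite (le_trans (normc_rhoh xi))// Normc.normcM /=.
  by rewrite expr0n addr0 sqrtr_sqr gtr0_norm.
- apply: eq_integrable iLr => // xi _; rewrite -EFinM; congr EFin.
  by case: (h xi) => u v /=; rewrite mul0r subr0.
- apply: eq_integrable iLi => // xi _; rewrite -EFinM; congr EFin.
  by case: (h xi) => u v /=; rewrite mul0r addr0.
Qed.

(** The factor exp(i t rho) has modulus 1, so the bound is the same at every time. The inequality is
    used with sign 1 and with the roles of [x] and [xi] exchanged. *)
Let I_wave_gen t (g : Rn R n -> R[i]) :
  mu.-integrable setT (fun x => (complex.Re (g x))%:E) ->
  mu.-integrable setT (fun x => (complex.Im (g x))%:E) ->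
  (\int[mu]_x (Normc.normc (Cintegral (fun xi =>
     expi (dotp xi x) * (expi (t * rho xi) * g xi))) ^+ 2)%:E <=
   ((2 * pi) ^+ n)%:E * I g)%E.
Proof.
move=> ir ii.
have mt : measurable_fun setT (fun xi => t * rho xi) by exact: measurable_funM.
have [irp iip] := integrable_phase mt ir ii.
have := bessel_fourier (expr1n R 2) irp iip.
under [X in (_ <= _ * X)%E -> _]eq_integral do rewrite normc_expiM.
apply: le_trans; apply: le_integral_nonneg => x; first by rewrite lee_fin sqr_ge0.
suff -> : Cintegral (fun xi => expi (dotp xi x) * (expi (t * rho xi) * g xi)) =
  Cintegral (fun xi => expi (1 * dotp x xi) * (expi (t * rho xi) * g xi)) by [].
congr Cintegral; apply/funext => xi; rewrite mul1r; congr (expi _ * _).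
by apply: eq_bigr => i _; rewrite mulrC.
Qed.

Lemma wave_L2 t :
  (\int[mu]_x (Normc.normc (wave t x) ^+ 2)%:E <= ((2 * pi) ^+ n)%:E * I h)%E.
Proof. exact: I_wave_gen. Qed.

Lemma wave_deriv_L2 t :
  (\int[mu]_x (Normc.normc (wave_deriv t x) ^+ 2)%:E <=
   ((2 * pi) ^+ n)%:E * ((L ^+ 2)%:E * I h))%E.
Proof.
case: irhoh => ir ii; apply: (le_trans (I_wave_gen t ir ii)).
rewrite lee_wpmul2l//; first by rewrite lee_fin exprn_ge0// mulr_ge0// pi_ge0.
rewrite -ge0_integralZl//; last 3 first.
- by apply/measurable_EFinP; apply: measurable_funX; exact: measurable_normc.
- by move=> x _; rewrite lee_fin sqr_ge0.
- by rewrite lee_fin sqr_ge0.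
apply: le_integral_nonneg => x; first by rewrite lee_fin sqr_ge0.
rewrite lee_fin -exprMn lerXn2r ?nnegrE ?normc_ge0//.
by rewrite mulr_ge0 ?normc_ge0// ltW.
Qed.

(** Tonelli brings the integral in x inside the one over [J], where the fixed-time bounds hold
    uniformly; integrating a constant over [J] yields the factor |J|. *)
Lemma wave_bound_L2 (J : set R) (s k : R) :
  measurable J -> (leb J < +oo)%E -> 0 <= k ->
  (\int[mu]_x (k%:E * ((Normc.normc (wave s x) ^+ 2)%:E +
    \int[leb]_(r in J) (L * Normc.normc (wave r x) ^+ 2 +
      L^-1 * Normc.normc (wave_deriv r x) ^+ 2)%:E)) <=
   (k * ((2 * pi) ^+ n * (1 + 2 * L * fine (leb J))))%:E * I h)%E.
Proof.
move=> mJ Jfin k0.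
have Li : 0 <= L^-1 by rewrite invr_ge0 ltW.
have L0 : 0 <= L by exact: ltW.
have mw := measurable_normc (measurable_wave_gen mh).
have mw' := measurable_normc (measurable_wave_gen mrhoh).
pose G (z : Rn R n * measurableTypeR R) : R :=
  L * Normc.normc (wave z.2 z.1) ^+ 2 + L^-1 * Normc.normc (wave_deriv z.2 z.1) ^+ 2.
have G0 z : 0 <= G z by rewrite addr_ge0// mulr_ge0// sqr_ge0.
have mG : measurable_fun setT G.
  apply: measurable_funD; (apply: measurable_funM; first by []);
  by apply: measurable_funX.
(* An indicator replaces the restriction to [J], so that Tonelli is applied on the whole product
   space. *)
pose GJ (z : Rn R n * measurableTypeR R) : \bar R := (G z * \1_J z.2)%:E.
have GJ0 z : (0 <= GJ z)%E by rewrite lee_fin mulr_ge0.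
have mGJ : measurable_fun setT GJ.
  apply/measurable_EFinP; apply: measurable_funM => //.
  by apply: (measurableT_comp (measurable_indic mJ)).
have GJE x : (\int[leb]_(r in J) (G (x, r))%:E = \int[leb]_r GJ (x, r))%E.
  rewrite integral_mkcond; apply: eq_integral => r _.
  rewrite /GJ patchE indicE /=; case: ifP => _; first by rewrite mulr1.
  by rewrite mulr0.
under eq_integral do rewrite [X in (_ + X)%E]GJE.
rewrite EFinM -muleA.
have mws : measurable_fun setT (fun x => Normc.normc (wave s x)).
  exact: (measurableT_comp mw (measurable_pair2 s)).
have mws' r : measurable_fun setT (fun x => Normc.normc (wave r x)).
  exact: (measurableT_comp mw (measurable_pair2 r)).
have mwd r : measurable_fun setT (fun x => Normc.normc (wave_deriv r x)).
  exact: (measurableT_comp mw' (measurable_pair2 r)).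
have pin0 : 0 <= (2 * pi) ^+ n :> R by rewrite exprn_ge0// mulr_ge0// pi_ge0.
have I0 : (0 <= I h)%E by apply: integral_ge0 => x _; rewrite lee_fin sqr_ge0.
rewrite ge0_integralZl//; last 2 first.
- apply: emeasurable_funD; last exact: (measurable_fun_fubini_tonelli_F GJ).
  by apply/measurable_EFinP; exact: measurable_funX.
- by move=> x _; rewrite adde_ge0 ?integral_ge0// lee_fin sqr_ge0.
rewrite lee_wpmul2l ?lee_fin//.
rewrite ge0_integralD//; last 4 first.
- by move=> x _; rewrite lee_fin sqr_ge0.
- by apply/measurable_EFinP; exact: measurable_funX.
- by move=> x _; exact: integral_ge0.
- exact: (measurable_fun_fubini_tonelli_F GJ).
rewrite fubini_tonelli//.
have inner r : (\int[mu]_x (G (x, r))%:E <=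
    ((2 * pi) ^+ n * (2 * L))%:E * I h)%E.
  rewrite (eq_integral (fun x => L%:E * (Normc.normc (wave r x) ^+ 2)%:E +
    L^-1%:E * (Normc.normc (wave_deriv r x) ^+ 2)%:E)%E); last by [].
  rewrite ge0_integralD//; last 4 first.
  - by move=> x _; rewrite -EFinM lee_fin mulr_ge0// sqr_ge0.
  - by apply: measurable_funeM; apply/measurable_EFinP; exact: measurable_funX.
  - by move=> x _; rewrite -EFinM lee_fin mulr_ge0// sqr_ge0.
  - by apply: measurable_funeM; apply/measurable_EFinP; exact: measurable_funX.
  rewrite !ge0_integralZl//; last 4 first.
  - by apply/measurable_EFinP; exact: measurable_funX.
  - by move=> x _; rewrite lee_fin sqr_ge0.
  - by apply/measurable_EFinP; exact: measurable_funX.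
  - by move=> x _; rewrite lee_fin sqr_ge0.
  (* The weights are balanced: the derivative costs L^2, so it contributes L^-1 L^2 = L, as much as
     the wave itself, whence 2 L. *)
  apply: (@le_trans _ _ (L%:E * (((2 * pi) ^+ n)%:E * I h) +
    L^-1%:E * (((2 * pi) ^+ n)%:E * ((L ^+ 2)%:E * I h)))%E).
    by apply: leeD; apply: lee_wpmul2l => //; [exact: wave_L2|exact: wave_deriv_L2].
  rewrite !muleA -!EFinM -ge0_muleDl ?lee_fin ?mulr_ge0 ?sqr_ge0// -EFinD.
  rewrite lee_wpmul2r// lee_fin le_eqVlt; apply/orP; left; apply/eqP.
  by field; rewrite gt_eqF.
rewrite mulrDr mulr1 EFinD ge0_muleDl ?lee_fin ?mulr_ge0 ?fine_ge0//.
apply: leeD; first exact: wave_L2.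
apply: (@le_trans _ _
  (\int[leb]_r ((((2 * pi) ^+ n * (2 * L))%:E * I h) * (\1_J r)%:E))%E).
  apply: le_integral_nonneg => r; first exact: integral_ge0.
  rewrite /GJ /=; under eq_integral do rewrite EFinM.
  rewrite ge0_integralZr//; last 2 first.
  - by apply/measurable_EFinP; exact: (measurableT_comp mG (measurable_pair2 r)).
  - by move=> x _; rewrite lee_fin.
  by rewrite lee_wpmul2r// lee_fin.
rewrite ge0_integralZl//; last 2 first.
- by apply/measurable_EFinP; exact: measurable_indic.
- by rewrite mule_ge0// lee_fin !mulr_ge0.
have -> : (\int[leb]_r (\1_J r)%:E = leb J)%E.
  by rewrite [LHS](@integral_indic _ (measurableTypeR R) R leb
    setT measurableT J mJ) setIT.
rewrite muleAC -{1}(fineK (x := leb J)) ?ge0_fin_numE//.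
by rewrite -EFinM -!mulrA.
Qed.

End wave.

(** * Truncation to a ball *)

Section ball.
Context {R : realType} (n : nat).

Lemma measurable_enorm : measurable_fun setT (@enorm R n).
Proof.
apply: (@measurableT_comp _ _ _ _ _ _ (@Num.sqrt R)).
  by apply: continuous_measurable_fun; exact: sqrt_continuous.
by apply: (@measurable_dotp R n _ (Rn R n) id id).
Qed.

Lemma tnth_le_enorm (x : Rn R n) i : `|tnth x i : R| <= enorm x.
Proof.
rewrite -sqrtr_sqr; apply: ler_wsqrtr; rewrite /dotp (bigD1 i)//= -expr2.
by rewrite lerDl; apply: sumr_ge0 => j _; rewrite -expr2 sqr_ge0.
Qed.

Lemma measurable_ball (r : R) : measurable [set x : Rn R n | enorm x <= r].
Proof.
rewrite (_ : [set x | _] = @enorm R n @^-1` `]-oo, r]).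
  by rewrite -[X in measurable X]setTI; apply: measurable_enorm.
by apply/seteqP; split => x /=; rewrite in_itv.
Qed.

(** The ball lies in the cube [-r, r]^n, whose measure is a finite product. *)
Lemma ball_finite (r : R) :
  (lebesgue_Rn n [set x : Rn R n | (enorm x <= r)%R] < +oo)%E.
Proof.
apply: (@le_lt_trans _ _ (lebesgue_Rn n
    [set x : Rn R n | forall i, `[- r, r]%classic (tnth x i)])).
  apply: le_measure; rewrite ?inE.
  - exact: measurable_ball.
  - rewrite (_ : mkset _ = \big[setI/setT]_(i < n)
      ((fun x : Rn R n => tnth x i) @^-1` `[- r, r])).
      apply: bigsetI_measurable => i _; rewrite -[X in measurable X]setTI.
      exact: measurable_tnth.
    apply/seteqP; split => x /=; rewrite -bigcap_seq => h i.
      by move=> _; exact: h.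
    by apply: h; rewrite /= mem_index_enum.
  - move=> x /= xr i; rewrite in_itv/= -ler_norml.
    exact: le_trans (tnth_le_enorm x i) xr.
rewrite [ltLHS](@lebesgue_Rn_box R n (fun=> `[- r, r]%classic))//.
rewrite (eq_bigr (fun=> (fine (lebesgue_measure `[- r, r]%classic))%:E)) => [|i _].
  by rewrite prodEFin ltry.
by rewrite fineK// lebesgue_measure_itv; case: ifP => _; rewrite -?EFinD.
Qed.

End ball.

Section truncation.
Context {R : realType} (n : nat) (a lambda : R) (fhat : Rn R n -> R[i]).
Hypotheses (a_gt0 : 0 < a) (l1 : 1 <= lambda) (Lfhat : LpC 2%:E fhat)
  (supp : {ae lebesgue_Rn n, forall xi, ~ enorm xi <= lambda -> fhat xi = 0}).
Let mu := @lebesgue_Rn R n.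
Let B := [set xi : Rn R n | enorm xi <= lambda].

(** Cutting off the symbol as well as [fhat] makes it bounded by lambda^a at every point, as the
    hypothesis [rhoL] of the wave estimates asks. *)
Definition truncated_symbol xi : R := \1_B xi * enorm xi `^ a.

Definition truncated xi : R[i] := (\1_B xi)%:C%C * fhat xi.

Let mB : measurable B. Proof. exact: measurable_ball. Qed.

Let m1B : measurable_fun setT (\1_B : Rn R n -> R).
Proof. exact: measurable_indic. Qed.

Lemma measurable_truncated_symbol : measurable_fun setT truncated_symbol.
Proof.
apply: measurable_funM => //.
apply: (@measurableT_comp _ _ _ _ _ _ (fun r : R => r `^ a)) => //.
exact: measurable_enorm.
Qed.

Lemma truncated_symbol_le xi : `|truncated_symbol xi| <= lambda `^ a.
Proof.
rewrite /truncated_symbol indicE; case: (boolP (xi \in B)) => [|_].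
  rewrite inE mul1r ger0_norm ?powR_ge0// => xiB.
  apply: ge0_ler_powR => //; first exact: ltW.
    by rewrite nnegrE sqrtr_ge0.
  by rewrite nnegrE (le_trans _ l1).
by rewrite mul0r normr0 powR_ge0.
Qed.

Let mfhat : measurable_complex fhat. Proof. by case: Lfhat. Qed.

Let Re_truncated xi : complex.Re (truncated xi) = \1_B xi * complex.Re (fhat xi).
Proof. by rewrite /truncated; case: (fhat xi) => u v /=; rewrite mul0r subr0. Qed.

Let Im_truncated xi : complex.Im (truncated xi) = \1_B xi * complex.Im (fhat xi).
Proof. by rewrite /truncated; case: (fhat xi) => u v /=; rewrite mul0r addr0. Qed.

Lemma measurable_truncated : measurable_complex truncated.
Proof.
case: mfhat => mr mi; split.
  by under eq_fun do rewrite Re_truncated; exact: measurable_funM.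
by under eq_fun do rewrite Im_truncated; exact: measurable_funM.
Qed.

Lemma normc_truncated_le xi : Normc.normc (truncated xi) <= Normc.normc (fhat xi).
Proof.
rewrite Normc.normcM -[leRHS]mul1r ler_wpM2r ?normc_ge0//=.
rewrite expr0n addr0 sqrtr_sqr indicE.
by case: (xi \in B) => /=; rewrite ?normr1 ?normr0.
Qed.

(** Square integrability on a set of finite measure gives integrability: the pointwise bound w <= 1
    + w^2 on the ball takes the place of Cauchy-Schwarz. *)
Lemma integrable_truncated :
  mu.-integrable setT (fun xi => (complex.Re (truncated xi))%:E) /\
  mu.-integrable setT (fun xi => (complex.Im (truncated xi))%:E).
Proof.
have i1 : mu.-integrable setT (EFin \o (\1_B : Rn R n -> R)).
  apply/integrableP; split; first exact/measurable_EFinP.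
  under eq_integral do rewrite /= ger0_norm//.
  by rewrite integral_indic// setIT; exact: ball_finite.
have i2 : mu.-integrable setT (EFin \o (fun xi => Normc.normc (fhat xi) ^+ 2)).
  apply/integrableP; split.
    by apply/measurable_EFinP; apply: measurable_funX; exact: measurable_normc.
  case: Lfhat => _ _; rewrite LpnormC2E => /lty_poweRy.
  rewrite invr_eq0 pnatr_eq0 => /(_ erefl).
  by under eq_integral do rewrite -[X in X%:E]ger0_norm ?sqr_ge0//.
have i12 := integrableD measurableT i1 i2.
have [mr mi] := measurable_truncated.
have bnd xi : Normc.normc (truncated xi) <= \1_B xi + Normc.normc (fhat xi) ^+ 2.
  rewrite Normc.normcM /= expr0n addr0 sqrtr_sqr indicE.
  case: (xi \in B) => /=; last by rewrite normr0 mul0r add0r sqr_ge0.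
  rewrite normr1 mul1r; set w := Normc.normc _.
  have := sqr_ge0 (w - 1); have := normc_ge0 (fhat xi); rewrite -/w.
  by rewrite sqrrB; nra.
by split; apply: (integrable_le _ i12) => // xi; apply: le_trans (bnd xi);
  case: (normc_ReIm (truncated xi)).
Qed.

(** The integrands agree on the ball, and off it [fhat] vanishes almost everywhere. The exceptional
    set of [xi] does not depend on [t] or [x], so equality holds for all of them, as a supremum over
    [J] requires. *)
Lemma propagator_truncated t x : propagator a t fhat x =
  ((2 * pi) ^- n)%:C%C * wave truncated_symbol truncated t x.
Proof.
rewrite /propagator; congr (_ * _).
have mt : measurable_fun setT (fun xi : Rn R n => t * enorm xi `^ a).
  apply: measurable_funM => //.
  apply: (@measurableT_comp _ _ _ _ _ _ (fun r : R => r `^ a)) => //.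
  exact: measurable_enorm.
have md : measurable_fun setT (fun xi : Rn R n => dotp xi x).
  by apply: (@measurable_dotp R n _ (Rn R n) id (fun=> x)).
have [ml1 ml2] := measurable_expiM md (measurable_expiM mt mfhat).
have mt' : measurable_fun setT (fun xi => t * truncated_symbol xi).
  by apply: measurable_funM => //; exact: measurable_truncated_symbol.
have [mr1 mr2] := measurable_expiM md (measurable_expiM mt' measurable_truncated).
have E : {ae mu, forall xi,
    expi (dotp xi x) * (expi (t * enorm xi `^ a) * fhat xi) =
    expi (dotp xi x) * (expi (t * truncated_symbol xi) * truncated xi)}.
  apply: filterS supp => xi xi0; rewrite /truncated_symbol /truncated indicE.
  case: (boolP (xi \in B)) => [_|]; first by rewrite !mul1r.
  by rewrite notin_setE => /xi0 ->; rewrite !mulr0.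
rewrite /wave /Cintegral; congr (_ +i* _)%C; rewrite /Rintegral; congr fine;
  under eq_integral do rewrite -mulrA;
  apply: ae_eq_integral => //; try exact/measurable_EFinP;
  by apply: filterS E => xi + _ => ->.
Qed.

End truncation.

(** * The maximal estimate *)

Lemma maximal_propagator_L2 (R : realType) (a : R) (n : nat) (lambda : R)
    (J : set R) (fhat : Rn R n -> R[i]) :
  0 < a -> 1 <= lambda -> is_interval J -> (lebesgue_measure J < +oo)%E ->
  LpC 2%:E fhat ->
  {ae lebesgue_Rn n, forall xi, ~ enorm xi <= lambda -> fhat xi = 0} ->
  ('N[lebesgue_Rn n]_2%:E [maximal_propagator a J fhat] <=
   ((2 * pi) ^- n * Num.sqrt ((2 * pi) ^+ n) *
     Num.sqrt (1 + 2 * lambda `^ a * fine (lebesgue_measure J)))%:E *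
   LpnormC 2%:E fhat)%E.
Proof.
move=> a0 l1 iJ Jfin L2fhat supp.
set L := lambda `^ a; set c := (2 * pi) ^- n; set jj := fine _.
have pi2 : 0 < 2 * pi :> R by rewrite mulr_gt0// pi_gt0.
have c0 : 0 < c by rewrite invr_gt0 exprn_gt0.
have L0 : 0 < L by rewrite powR_gt0// (lt_le_trans _ l1).
have j0 : 0 <= jj by rewrite fine_ge0.
have E0 : 0 <= 1 + 2 * L * jj by rewrite addr_ge0// !mulr_ge0// ltW.
have k0 : 0 <= c * Num.sqrt ((2 * pi) ^+ n) * Num.sqrt (1 + 2 * L * jj).
  by rewrite !mulr_ge0 ?sqrtr_ge0// ltW.
have mJ : measurable J by exact: is_interval_measurable.
(* For empty [J] the outer maximum with 0 makes the maximal function 0; otherwise some [s] in [J]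
   serves as reference time. *)
have [->|/set0P[s Js]] := eqVneq J set0.
  rewrite (_ : maximal_propagator _ _ _ = cst 0%E); last first.
    apply/funext => x; rewrite /maximal_propagator image_set0 ereal_sup0.
    by rewrite maxEle leNgt ltNyr.
  by rewrite Lnorm0// mule_ge0// Lnorm_ge0.
pose rho : Rn R n -> R := truncated_symbol a lambda.
pose h := truncated lambda fhat.
have mrho : measurable_fun setT rho by exact: measurable_truncated_symbol.
have rhoL xi : `|rho xi| <= L by exact: truncated_symbol_le.
have [ihr ihi] := @integrable_truncated R n lambda fhat L2fhat.
rewrite -/h in ihr ihi.
(* [D x] does not involve the running time t, and it bounds the squared modulus of the wave for all
   times in [J]. *)
pose D x : \bar R := ((Normc.normc (wave rho h s x) ^+ 2)%:E +
  \int[lebesgue_measure]_(r in J) (L * Normc.normc (wave rho h r x) ^+ 2 +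
      L^-1 * Normc.normc (wave_deriv rho h r x) ^+ 2)%:E)%E.
have D0 x : (0 <= D x)%E.
  rewrite adde_ge0 ?lee_fin ?sqr_ge0// integral_ge0// => r _.
  by rewrite lee_fin addr_ge0// mulr_ge0 ?sqr_ge0// ?invr_ge0 ltW.
have normc_propagator t x :
    Normc.normc (propagator a t fhat x) = c * Normc.normc (wave rho h t x).
  rewrite (propagator_truncated a L2fhat supp) Normc.normcM /=.
  by rewrite expr0n addr0 sqrtr_sqr gtr0_norm.
have maxD x : (`|maximal_propagator a J fhat x| `^ 2 <= (c ^+ 2)%:E * D x)%E.
  have cD0 : (0 <= (c ^+ 2)%:E * D x)%E by rewrite mule_ge0// lee_fin sqr_ge0.
  have m0 : (0 <= maximal_propagator a J fhat x)%E.
    by rewrite /maximal_propagator le_max lexx.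
  (* The supremum is taken before squaring, so it is compared with the square root of the bound and
     both sides are squared afterwards. *)
  have half2 : ((((c ^+ 2)%:E * D x) `^ 2^-1) `^ 2 = (c ^+ 2)%:E * D x)%E.
    by rewrite -poweRrM mulVf// poweRe1.
  rewrite gee0_abs// -half2; apply: gt0_ler_poweR => //.
  - by rewrite in_itv/= m0 leey.
  - by rewrite in_itv/= poweR_ge0 leey.
  rewrite /maximal_propagator ge_max poweR_ge0 andTb.
  apply: ge_ereal_sup => _ [t Jt <-].
  rewrite normc_propagator.
  have -> : ((c * Normc.normc (wave rho h t x))%:E =
      ((c * Normc.normc (wave rho h t x)) ^+ 2)%:E `^ 2^-1)%E.
    rewrite poweR_EFin powR12_sqrt ?sqr_ge0// sqrtr_sqr ger0_norm//.
    by rewrite mulr_ge0 ?normc_ge0// ltW.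
  apply: gt0_ler_poweR => //.
  - by rewrite in_itv/= leey lee_fin sqr_ge0.
  - by rewrite in_itv/= leey cD0.
  rewrite exprMn EFinM lee_wpmul2l ?lee_fin ?sqr_ge0//.
  exact: (wave_sqr_le mrho rhoL L0 ihr ihi).
rewrite LpnormC2E unlock; apply: le_poweR_half => //.
- by apply: integral_ge0 => x _; exact: poweR_ge0.
- by apply: integral_ge0 => x _; rewrite lee_fin sqr_ge0.
apply: (@le_trans _ _ (\int[lebesgue_Rn n]_x ((c ^+ 2)%:E * D x))%E).
  by apply: le_integral_nonneg => // x; exact: poweR_ge0.
have := wave_bound_L2 mrho rhoL L0 ihr ihi s mJ Jfin (sqr_ge0 c).
move=> /le_trans; apply.
rewrite (exprMn 2 (c * _)) (exprMn 2 c) !sqr_sqrtr ?exprn_ge0 ?(ltW pi2)//.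
rewrite -(mulrA (c ^+ 2)).
rewrite lee_wpmul2l//.
  by rewrite lee_fin !mulr_ge0 ?exprn_ge0 ?(ltW pi2) ?(ltW c0).
apply: le_integral_nonneg => x; first by rewrite lee_fin sqr_ge0.
by rewrite lee_fin lerXn2r ?nnegrE ?normc_ge0// normc_truncated_le.
Qed.

Unset Implicit Arguments.

Theorem theorem1 (R : realType) (a : R) (n : nat) (a_gt0 : 0 < a)
    (n_ge1 : (1 <= n)%N) :
  exists C : R, forall (lambda : R) (J : set R) (f fhat : Rn R n -> R[i]),
    1 <= lambda ->
    is_interval J -> J `<=` [set t | 0 <= t <= 1] ->
    LpC 2%:E f -> is_fourier f fhat ->
    ess_support fhat `<=` [set xi | enorm xi <= lambda] ->
    ('N[lebesgue_Rn n]_2%:E [maximal_propagator a J fhat] <=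
     (1 + C * Num.sqrt (fine (lebesgue_measure J)) * lambda `^ (a / 2))%:E *
     LpnormC 2%:E f)%E.
Proof.
exists (Num.sqrt 2) => lambda J f fhat l1 iJ J01 L2f fF supp.
have L2fhat : LpC 2%:E fhat by case: fF.
(* Finiteness ensures that [fine] returns the true length of [J]. *)
have Jfin : (lebesgue_measure J < +oo)%E.
  apply: (@le_lt_trans _ _ (lebesgue_measure (`[0%R, 1%R]%classic : set R))).
    apply: le_measure; rewrite ?inE.
    - exact: is_interval_measurable.
    - exact: measurable_itv.
    - by move=> t /J01; rewrite /= in_itv.
  by rewrite lebesgue_measure_itv/= lte_fin ltr01 -EFinB ltry.
have := maximal_propagator_L2 a_gt0 l1 iJ Jfin L2fhat (ess_support_ae supp).
set L := lambda `^ a; set jj := fine _ => /le_trans; apply.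
have pi2 : 0 < (2 * pi) ^+ n :> R by rewrite exprn_gt0// mulr_gt0// pi_gt0.
have L0 : 0 <= L by rewrite powR_ge0.
have j0 : 0 <= jj by rewrite fine_ge0.
have E0 : 0 <= 1 + 2 * L * jj by rewrite addr_ge0// !mulr_ge0.
set S := Num.sqrt ((2 * pi) ^+ n).
apply: (@le_trans _ _ (((2 * pi) ^- n * S * Num.sqrt (1 + 2 * L * jj))%:E *
    (S%:E * LpnormC 2%:E f))%E).
  rewrite lee_wpmul2l ?fourier_L2// lee_fin !mulr_ge0 ?sqrtr_ge0//.
  by rewrite invr_ge0 ltW.
rewrite muleA -EFinM lee_wpmul2r ?Lnorm_ge0// lee_fin.
(* The two Plancherel losses multiply to S^2 = (2 pi)^n and cancel the normalisation of the
   propagator. *)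
have -> : (2 * pi) ^- n * S * Num.sqrt (1 + 2 * L * jj) * S =
    Num.sqrt (1 + 2 * L * jj).
  rewrite mulrAC -[_ * S * S]mulrA -expr2 sqr_sqrtr ?(ltW pi2)//.
  by rewrite mulVf ?mul1r// gt_eqF.
set y := Num.sqrt 2 * _ * _.
have y0 : 0 <= y by rewrite !mulr_ge0 ?sqrtr_ge0// powR_ge0.
have y2 : y ^+ 2 = 2 * L * jj.
  rewrite /y !exprMn !sqr_sqrtr// -powR_mulrn ?powR_ge0// -powRrM divfK//.
  by rewrite mulrAC.
(* With y^2 = 2 L |J| the claim is 1 + y^2 <= (1 + y)^2, which dictates the choice of sqrt 2 as
   constant. *)
rewrite -[leRHS]ger0_norm ?addr_ge0// -sqrtr_sqr; apply: ler_wsqrtr.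
by rewrite sqrrD expr1n -y2 mul1r lerD2r lerDl mulrn_wge0.
Qed.
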